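(* Let $(\Omega,\mathcal{F},\mu;(\mathcal{F}_i)_{i\in\mathbb{Z}})$ be a $\sigma$-finite filtered measure space, let $\alpha=(\alpha_i)_{i\in\mathbb{Z}}$ where each $\alpha_i$ is a nonnegative bounded $\mathcal{F}_i$-measurable function, let $1<p\leq q<\infty$, and let $\omega$ be a weight. Then the following statements are equivalent: (1) There exists a positive constant $C$ such that for all nonnegative $f\in L^p(\omega)$ and $g\in L^{q'}(\omega)$, $$\|T_{\alpha}(f\omega,g\omega)\|_{L^1(d\mu)}\leq C\|f\|_{L^p(\omega)}\|g\|_{L^{q'}(\omega)}. \qquad (a)$$ (2) There exist positive constants $C_1$ and $C_2$ such that for every $i\in\mathbb{Z}$ and every $E\in\mathcal{F}_i^0$, $$\Big(\int_E\Big(\sum_{j\geq i}\mathbb{E}_j(\omega)\alpha_j\Big)^q\omega\, d\mu\Big)^{\frac1q}\leq C_1\,\omega(E)^{\frac1p}, \qquad (b)$$ $$\Big(\int_E\Big(\sum_{j\geq i}\mathbb{E}_j(\omega)\alpha_j\Big)^{p'}\omega\, d\mu\Big)^{\frac1{p'}}\leq C_2\,\omega(E)^{\frac1{q'}}. \qquad (c)$$ Moreover, denoting the smallest constants $C$, $C_1$, $C_2$ in (a), (b), (c) by $\|T_\alpha(\cdot\,\omega)\|$, $[\omega,\omega]_{\alpha,q',p'}$ and $[\omega,\omega]_{\alpha,p,q}$, respectively, one has $$[\omega,\omega]_{\alpha,q',p'}\leq\|T_\alpha(\cdot\,\omega)\|,\qquad [\omega,\omega]_{\alpha,p,q}\leq\|T_\alpha(\cdot\,\omega)\|,$$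 and $$\|T_\alpha(\cdot\,\omega)\|\lesssim[\omega,\omega]_{\alpha,q',p'}+[\omega,\omega]_{\alpha,p,q}.$$
   Context: A $\sigma$-finite filtered measure space $(\Omega,\mathcal{F},\mu;(\mathcal{F}_i)_{i\in\mathbb{Z}})$ consists of a measure space with sub-$\sigma$-algebras $\mathcal{F}_i\subset\mathcal{F}$, $i\in\mathbb{Z}$, such that $\mathcal{F}_i\subset\mathcal{F}_j$ for $i<j$; all measure spaces, including every $(\Omega,\mathcal{F}_i,\mu)$, are assumed $\sigma$-finite. $\mathcal{F}_i^0$ denotes the collection of sets in $\mathcal{F}_i$ of finite $\mu$-measure. $\mathcal{L}$ is the set of $\mathcal{F}$-measurable functions $f:\Omega\to\mathbb{R}$ such that $\chi_E f\in L^1(\mathcal{F},\mu)$ for all $E\in\mathcal{F}_i^0$ and all $i\in\mathbb{Z}$. For $f\in\mathcal{L}$, $\mathbb{E}_i(f)=\mathbb{E}(f|\mathcal{F}_i)$ is the conditional expectation: the a.e. unique $\mathcal{F}_i$-measurable function, integrable on every $G\in\mathcal{F}_i^0$, with $\int_G \mathbb{E}_i(f)\,d\mu=\int_G f\,d\mu$ for all $G\in\mathcal{F}_i^0$. A weight is a nonnegative function in $\mathcal{L}$. For a weight $w$, $w(E)=\int_E w\,d\mu$ and $L^p(w)=L^p(\Omega,w\,d\mu)$. The bilinear positive operator is $T_\alpha(f,g)=\sum_{i\in\mathbb{Z}}\alpha_i\,\mathbb{E}_i(f)\,\mathbb{E}_i(g)$. The conjugate exponent of $p$ is $p'$, $\frac1p+\frac1{p'}=1$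 (likewise $q'$). The notation $A\lesssim B$ means $A\leq CB$ with a constant $C$ independent of the weights and weight constants (it may depend on $p,q$). A smallest constant is understood as $+\infty$ if no finite constant works. *)

(* Defs.v *)
From HB Require Import structures.
From mathcomp Require Import all_boot all_order all_algebra.
From mathcomp Require Import all_classical all_reals all_analysis.

Set Implicit Arguments.
Unset Strict Implicit.
Unset Printing Implicit Defensive.

Import Order.TTheory GRing.Theory Num.Theory.
Import numFieldNormedType.Exports.

Local Open Scope classical_set_scope.
Local Open Scope ring_scope.
Local Open Scope ereal_scope.

Section filtered_measure_space.
Context (d : measure_display) (T : measurableType d) (R : realType).
Variable mu : {measure set T -> \bar R}.

(* The ambient sigma-algebra is the one carried by T; sub-sigma-algebras are
   plain set systems on T. *)
Record sigma_finite_filtration (F : int -> set (set T)) : Prop := {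
  filtration_sigma_finite : sigma_finite [set: T] mu ;
  filtration_sigma_algebra : forall i, sigma_algebra [set: T] (F i) ;
  filtration_sub : forall i, F i `<=` measurable ;
  filtration_mono : forall i j, (i < j)%R -> F i `<=` F j ;
  filtration_sub_sigma_finite : forall i, exists2 A : (set T)^nat,
    [set: T] = \bigcup_n A n & forall n, F i (A n) /\ mu (A n) < +oo }.

Definition finite_part (G : set (set T)) : set (set T) :=
  [set E | G E /\ mu E < +oo].

Definition measurable_wrt (G : set (set T)) (f : T -> R) : Prop :=
  forall B : set R, measurable B -> G (f @^-1` B).

(* The class written \mathcal{L}. *)
Definition locally_integrable (F : int -> set (set T)) (f : T -> R) : Prop :=
  measurable_fun [set: T] f /\
  forall i E, finite_part (F i) E -> mu.-integrable E (EFin \o f).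

Definition is_cond_exp (G : set (set T)) (f h : T -> R) : Prop :=
  [/\ measurable_wrt G h,
      forall E, finite_part G E -> mu.-integrable E (EFin \o h) &
      forall E, finite_part G E ->
        \int[mu]_(x in E) (h x)%:E = \int[mu]_(x in E) (f x)%:E ].

(* An arbitrary version, the conditional expectation being unique only up to
   a mu-null set; the default value is used only when no version exists. *)
Definition cond_exp (G : set (set T)) (f : T -> R) : T -> R :=
  xget (cst 0%R) [set h | is_cond_exp G f h].

Definition weight (F : int -> set (set T)) (w : T -> R) : Prop :=
  locally_integrable F w /\ forall x, (0 <= w x)%R.

Definition wmass (w : T -> R) (E : set T) : \bar R :=
  \int[mu]_(x in E) (w x)%:E.

Definition wnorm (w : T -> R) (p : R) (f : T -> R) : \bar R :=
  (\int[mu]_x (`|f x| `^ p * w x)%:E) `^ p^-1.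

Definition in_Lpw (w : T -> R) (p : R) (f : T -> R) : Prop :=
  measurable_fun [set: T] f /\ wnorm w p f < +oo.

Definition admissible (F : int -> set (set T)) (alpha : int -> T -> R) : Prop :=
  forall i, [/\ measurable_wrt (F i) (alpha i),
                forall x, (0 <= alpha i x)%R &
                exists M : R, forall x, (alpha i x <= M)%R].

Section operator.
Variables (F : int -> set (set T)) (alpha : int -> T -> R).

(* Only applied to nonnegative f and g: the terms are then nonnegative almost
   everywhere, so that the unordered sum is the sum of the series. *)
Definition T_op (f g : T -> R) (x : T) : \bar R :=
  \esum_(i in [set: int])
    (alpha i x * cond_exp (F i) f x * cond_exp (F i) g x)%:E.

Definition tail_sum (w : T -> R) (i : int) (x : T) : \bar R :=
  \esum_(j in [set j : int | (i <= j)%R]) (cond_exp (F j) w x * alpha j x)%:E.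

Definition bilinear_bound (w : T -> R) (p q' C : R) : Prop :=
  forall f g : T -> R,
    (forall x, 0 <= f x)%R -> (forall x, 0 <= g x)%R ->
    in_Lpw w p f -> in_Lpw w q' g ->
    'N[mu]_1[ T_op (f \* w)%R (g \* w)%R ]
      <= C%:E * wnorm w p f * wnorm w q' g.

Definition testing_bound (w : T -> R) (r s C : R) : Prop :=
  forall (i : int) (E : set T), finite_part (F i) E ->
    (\int[mu]_(x in E) (tail_sum w i x `^ r * (w x)%:E)) `^ r^-1
      <= C%:E * wmass w E `^ s^-1.

Definition T_op_norm (w : T -> R) (p q' : R) : \bar R :=
  ereal_inf [set C%:E | C in [set C | (0 <= C)%R /\ bilinear_bound w p q' C]].

Definition testing_const (w : T -> R) (r s : R) : \bar R :=
  ereal_inf [set C%:E | C in [set C | (0 <= C)%R /\ testing_bound w r s C]].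

End operator.

End filtered_measure_space.

(* Main.v *)
Require Import Defs.
From HB Require Import structures.
From mathcomp Require Import all_boot all_order all_algebra.
From mathcomp Require Import all_classical all_reals all_analysis.
From mathcomp Require Import measurable_realfun.
From mathcomp Require Import ring lra zify.

Set Implicit Arguments.
Unset Strict Implicit.
Unset Printing Implicit Defensive.

Import Order.TTheory GRing.Theory Num.Theory.
Import numFieldNormedType.Exports.

Local Open Scope classical_set_scope.
Local Open Scope ring_scope.

(** Let [sigma] be the measure with density [w] with respect to [mu], and write
[lam_i] for [alpha_i E_i(w)], [S_i] for the sum of the [lam_j] over [j >= i],
and [f_i] for [E_i(f w) / E_i(w)], which is the conditional expectation of [f]
with respect to [sigma]. Moving factors measurable for the i-th sigma-algebra
in and out of the conditional expectations turns the bilinear form into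

  int T(f w, g w) dmu  =  sum_i  int lam_i f_i g_i dsigma,

so that a single measure remains, and [S_i] is the function that is tested.

Necessity ([testing_necessary]). For [E] in the i-th sigma-algebra the choice
[f = 1_E] leaves the integral of [S_i g] over [E] as a lower bound for the form.
Take for [g] the power [q - 1] of the truncation of [S_i] at height [n],
restricted to [E]; the norm of [g] is then a power of the integral to be
bounded, that integral is finite, and it can be absorbed. Letting [n] grow
gives the bound on [S_i]. The other testing condition is the same statement
for the form with its two arguments exchanged.

Sufficiency ([testing_sufficient]). By Hoelder the testing condition gives

  int_E S_j dsigma  <=  C sigma(E)^(1 + e),     1 + e = 1/p + 1/q',

for [E] in the j-th sigma-algebra ([testing_window]). The form is a supremum
over finite windows of indices, and in a window one can stop: let [tau_j] be
the set where [a_i = f_i g_i] exceeds [t] for the first time at the index [j].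
On [tau_j] only indices [i >= j] contribute to the sum of the [lam_i] over all
[i] with [a_i > t], so this sum is at most [S_j] there. Testing on the sets
[tau_j], which are disjoint, and [e >= 0] give ([sum_superlevel_le])

  sum_i  int_{a_i > t} lam_i dsigma  <=  C sigma(max_i a_i > t)^(1 + e).

Summing over the levels [t = 2^k], and using Chebyshev's inequality for the
exponent [r = 1/(1 + e)] on the [e]-th power of the measure, bounds the form by
a multiple of the [L^r(sigma)] size of [max_i a_i] ([sum_stopped_le]). Since
[max_i a_i <= (max_i f_i) (max_i g_i)], Hoelder's inequality and Doob's maximal
inequality ([doob_maximal]) for the exponents [p] and [q'] finish the proof
([finite_bilinear_bound]). All constants come from geometric series in the
levels and depend only on the exponents. *)

(** * Sums over countable index sets *)

Lemma eq_lee (R : realType) (x y : \bar R) : x = y -> (x <= y)%E.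
Proof. by move=> ->. Qed.

Section countable_sums.
Local Open Scope ereal_scope.
Context (R : realType) (I : countType).
Implicit Types (a : I -> \bar R) (J : set I).

(** The supremum defining an unordered sum may leave out any index, hence skips
the negative terms. This makes the operator and the tail sums insensitive to
the sign of the chosen versions of conditional expectations. *)
Lemma esum_pos_part J a : \esum_(i in J) maxe 0 (a i) = \esum_(i in J) a i.
Proof.
apply/eqP; rewrite eq_le; apply/andP; split; last first.
  by apply: ub_ereal_sup => _ [A [finA AJ] <-]; apply: le_trans (ereal_sup_ubound _);
   [|exists A; [split|reflexivity]] => //; apply: lee_fsum => // i _; rewrite le_max lexx orbT.
apply: ub_ereal_sup => _ [A [finA AJ] <-]; apply: ereal_sup_ubound.
exists (A `&` [set i | 0 <= a i]).
  by split; [exact: finite_setIl|move=> i [/AJ]].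
rewrite fsbig_mkcondr; apply: eq_fsbigr => i _.
rewrite /patch; case: ifPn; rewrite ?inE ?notin_setE/=.
  by move=> a0; apply/esym/max_idPr.
by move/negP; rewrite -ltNge => /ltW a0; apply/esym/max_idPl.
Qed.

(** Gives access to monotone convergence, which concerns series over [nat]. *)
Lemma esum_pickle a : (forall i, 0 <= a i) ->
  \esum_(i in [set: I]) a i = \sum_(n <oo) oapp a 0 (pickle_inv n).
Proof.
move=> a0; have b0 n : 0 <= oapp a 0 (pickle_inv n).
  by case: pickle_inv => /=.
rewrite nneseries_esumT//.
rewrite (esum_mkcond [set: nat]) -[RHS](_ : \esum_(n in range (@pickle I))
    oapp a 0 (pickle_inv n) = _); last first.
  rewrite esum_mkcond; apply: eq_esum => n _; rewrite in_setT.
  case: ifPn => //; rewrite notin_setE/= => nI.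
  case E : pickle_inv => [i|//]; exfalso; apply: nI; exists i => //.
  by have := @pickle_invK I n; rewrite E.
rewrite (reindex_esum [set: I] _ pickle).
  by apply: eq_esum => i _; rewrite pickleK_inv.
split=> [i _|i j _ _|//]; first by exists i.
exact: (pcan_inj pickleK_inv).
Qed.

Context (d : measure_display) (T : measurableType d).
Variable mu : {measure set T -> \bar R}.
Implicit Types (D : set T) (f : I -> T -> \bar R).

Lemma integral_esum D J (f : I -> T -> \bar R) : measurable D ->
  (forall i, measurable_fun D (f i)) -> (forall i x, 0 <= f i x) ->
  \int[mu]_(x in D) (\esum_(i in J) f i x) =
  \esum_(i in J) (\int[mu]_(x in D) f i x).
Proof.
move=> mD mf f0.
transitivity (\int[mu]_(x in D) (\sum_(n <oo)
    oapp (fun i => if i \in J then f i x else 0) 0 (pickle_inv n))).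
  apply: eq_integral => x _; rewrite esum_mkcond esum_pickle// => i.
  by case: ifP.
rewrite esum_mkcond esum_pickle; last by move=> i; case: ifP => // _; exact: integral_ge0.
rewrite integral_nneseries//.
- apply: eq_eseriesr => n _; case: pickle_inv => [i|]/=; last exact: integral0.
  by case: (i \in J) => //; exact: integral0.
- move=> n; case: pickle_inv => [i|]/=; last exact: measurable_cst.
  by case: (i \in J) => //; exact: measurable_cst.
- by move=> n x _; case: pickle_inv => [i|]//=; case: ifP.
Qed.

Lemma emeasurable_esum D J (f : I -> T -> \bar R) :
  (forall i, measurable_fun D (f i)) -> (forall i x, 0 <= f i x) ->
  measurable_fun D (fun x => \esum_(i in J) f i x).
Proof.
move=> mf f0.
rewrite (_ : (fun _ => _) = (fun x => \sum_(n <oo)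
    oapp (fun i => if i \in J then f i x else 0) 0 (pickle_inv n))).
  apply: ge0_emeasurable_sum => n.
    by move=> x _ _; case: pickle_inv => [i|]//=; case: ifP.
  move=> _; case: pickle_inv => [i|]/=; last exact: measurable_cst.
  by case: (i \in J) => //; exact: measurable_cst.
apply/funext => x; rewrite esum_mkcond esum_pickle// => i.
by case: ifP.
Qed.

Lemma esumZl J a (k : R) : (0 <= k)%R -> (forall i, 0 <= a i) ->
  \esum_(i in J) (k%:E * a i) = k%:E * \esum_(i in J) a i.
Proof.
move=> k0 a0; rewrite [LHS]esum_mkcond [in RHS]esum_mkcond.
rewrite !esum_pickle; last 2 first.
- by move=> i; case: ifP.
- by move=> i; case: ifP => // _; rewrite mule_ge0.
rewrite -nneseriesZl//; last by move=> n _; case: pickle_inv => [i|]//=; case: ifP.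
apply: eq_eseriesr => n _; case: pickle_inv => [i|]/=; last by rewrite mule0.
by case: ifP; rewrite ?mule0.
Qed.

End countable_sums.

(** Every finite set of integers lies in a window, so a bound on the form is
needed only for finitely many consecutive indices; these have a first one, and
stopping times become available. *)
Lemma esum_int_le (R : realType) (t : int -> \bar R) (c : \bar R) :
  (forall i, (0 <= t i)%E) ->
  (forall (m : int) (n : nat), (\sum_(k < n) t (m + k%:Z)%R <= c)%E) ->
  (\esum_(i in [set: int]) t i <= c)%E.
Proof.
move=> t0 tc; apply: ge_ereal_sup => _ [A [/finite_seqP[s ->] _] <-].
pose M := (\max_(i <- s) `|i|)%N; pose e (k : nat) : int := - M%:Z + k%:Z.
apply: le_trans (tc (- M%:Z) (M.*2.+1)).
rewrite (fsbig_ord _ _ (fun k => t (e k))).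
have bij : set_bij `I_(M.*2.+1) (e @` `I_(M.*2.+1)) e.
  by split=> [i ki|i j _ _ /addrI[]//|//]; exists i.
rewrite -(reindex_fsbig e _ _ t bij).
apply: lee_fsum_nneg_subset => //.
- exact/finite_image/finite_II.
- move=> i; rewrite inE/= => si; rewrite inE/=.
  have iM : (`|i| <= M)%N by exact: leq_bigmax_seq.
  move: i iM {si} => z; rewrite /e => {}iM.
  by exists (absz (z + M%:Z)); lia.
Qed.

Lemma le_esum_subset (R : realType) (I : choiceType) (J K : set I) (a : I -> \bar R) :
  J `<=` K -> (\esum_(i in J) a i <= \esum_(i in K) a i)%E.
Proof.
move=> JK; apply: ereal_sup_le => _ [A [fA AJ] <-]; exists A => //.
by split=> //; exact: subset_trans JK.
Qed.

(** * Dyadic layers *)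

Section dyadic_layers.
Context (R : realType).
Implicit Types (y s : R) (k : int).

Definition dyadic k : R := 2 `^ k%:~R.

Lemma dyadic_gt0 k : 0 < dyadic k.
Proof. exact: powR_gt0. Qed.

Lemma dyadicD1 k : dyadic (k + 1) = 2 * dyadic k.
Proof.
rewrite /dyadic intrD powRD; last by rewrite pnatr_eq0 implybT.
by rewrite powRr1// mulrC.
Qed.

Lemma dyadic_bracket y : 0 < y -> exists k, dyadic k < y <= 2 * dyadic k.
Proof.
move=> y0; pose x := ln y / ln 2.
have l2 : 0 < ln (2 : R) by rewrite ln_gt0// ltr1n.
have yE : y = 2 `^ x.
  by rewrite /powR (@negbTE (2 == 0)) ?pnatr_eq0// divfK ?gt_eqF// lnK// posrE.
exists (Num.ceil x - 1); rewrite -dyadicD1 subrK /dyadic yE.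
rewrite !/powR (@negbTE (2 == 0)) ?pnatr_eq0// ltr_expR ler_expR.
rewrite ltr_pM2r// ler_pM2r//.
exact: ceil_itv.
Qed.

(** The largest power of 2 below [y] is at least [y / 2], so one term of the sum
is already large enough. *)
Lemma powR_le_dyadic s y : 0 < s -> 0 <= y ->
  ((y `^ s)%:E <= (2 `^ s)%:E *
    \esum_(k in [set: int]) (dyadic k `^ s * (dyadic k < y)%R%:R)%:E)%E.
Proof.
move=> s0; have t0 k : (0 <= (dyadic k `^ s * (dyadic k < y)%R%:R)%:E)%E.
  by rewrite lee_fin mulr_ge0// powR_ge0.
rewrite le_eqVlt => /predU1P[<-|y0].
  rewrite powR0 ?gt_eqF// mule_ge0// ?lee_fin ?powR_ge0//.
  by apply: esum_ge0 => k _; rewrite lee_fin mulr_ge0// powR_ge0.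
have [k /andP[ky yk]] := dyadic_bracket y0.
apply: (@le_trans _ _ ((2 `^ s)%:E * (dyadic k `^ s)%:E)%E).
  rewrite -EFinM lee_fin -powRM//; last exact/ltW/dyadic_gt0.
  by apply: ge0_ler_powR => //; rewrite ?nnegrE ?(ltW s0)// ?ltW// mulr_gt0// dyadic_gt0.
apply: lee_pmul => //; rewrite ?lee_fin ?powR_ge0//.
apply: esum_ge; exists [set k] => //=.
by rewrite fsbig_set1 ky mulr1.
Qed.

(** The constant is named by a predicate because it has to be chosen from the
exponent alone, before any measure space is given. *)
Definition dyadic_bound s (c : R) := 0 < c /\ forall y, 0 <= y ->
  (\esum_(k in [set: int]) (dyadic k `^ s * (dyadic k < y)%R%:R)%:E
    <= (c * y `^ s)%:E)%E.

(** A geometric series, dominated by its largest term, which is at most [y^s]. *)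
Lemma ex_dyadic_bound s : 0 < s -> exists c, dyadic_bound s c.
Proof.
move=> s0; pose z : R := 2 `^ (- s).
have z0 : 0 < z by exact: powR_gt0.
have l2 : 0 < ln (2 : R) by rewrite ln_gt0// ltr1n.
have z1 : z < 1.
  by rewrite /z /powR (@negbTE (2 == 0)) ?pnatr_eq0// expR_lt1 nmulr_rlt0// oppr_lt0.
exists (1 - z)^-1; split => [|y]; first by rewrite invr_gt0 subr_gt0.
rewrite le_eqVlt => /predU1P[<-|y0].
  rewrite powR0 ?gt_eqF// mulr0 (eq_esum (b := fun=> 0%E)) ?esum1// => k _.
  by rewrite ltNge ltW ?dyadic_gt0//= mulr0.
have [K /andP[Ky yK]] := dyadic_bracket y0.
have mono k l : (dyadic k < dyadic l) = (k < l)%R.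
  by rewrite /dyadic /powR (@negbTE (2 == 0)) ?pnatr_eq0// ltr_expR ltr_pM2r ?ltr_int// ln_gt0// ltr1n.
have kK k : (dyadic k < y) = (k <= K).
  apply/idP/idP => [ky|].
    by rewrite -ltzD1 -mono dyadicD1 (lt_le_trans ky).
  by rewrite le_eqVlt => /predU1P[->//|]; rewrite -mono => /lt_trans; apply.
rewrite (_ : esum _ _ = \esum_(k in [set k : int | (k <= K)%R]) (dyadic k `^ s)%:E)%E; last first.
  rewrite [RHS]esum_mkcond; apply: eq_esum => k _; rewrite kK.
  have -> : (k \in [set k : int | k <= K]) = (k <= K).
    by apply/idP/idP; rewrite inE.
  by case: (k <= K); rewrite ?mulr1 ?mulr0.
rewrite (reindex_esum [set: nat] _ (fun n : nat => K - n%:Z)); last first.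
  split.
  - by move=> n _ /=; rewrite gerBl.
  - by move=> i j _ _ /= /addrI/oppr_inj[].
  - move=> k /= kleK; exists `|K - k|%N => //.
    by rewrite gez0_abs ?subr_ge0// opprB addrCA subrr addr0.
rewrite -nneseries_esumT; last by move=> n; rewrite lee_fin powR_ge0.
have tE n : dyadic (K - n%:Z) `^ s = dyadic K `^ s * z ^+ n.
  rewrite /dyadic -powR_mulrn ?ltW// /z -!powRrM -powRD ?pnatr_eq0 ?implybT//.
  by congr (_ `^ _); rewrite intrB mulrBl mulNr (mulrC s).
apply: lime_le.
  by apply: is_cvg_nneseries => n _ _; rewrite lee_fin powR_ge0.
apply: nearW => N; rewrite sumEFin lee_fin.
under eq_bigr do rewrite tE.
rewrite -mulr_sumr mulrC; apply: ler_pM; rewrite ?powR_ge0 //.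
- by apply: sumr_ge0 => i _; rewrite exprn_ge0 ?ltW.
- rewrite -[leRHS]mulr1 ler_pdivlMl ?subr_gt0// big_mkord.
  have -> : (1 - z) * \sum_(i < N) z ^+ i = 1 - z ^+ N.
    by rewrite -[RHS]opprB subrX1 -mulNr opprB.
  by rewrite gerBl exprn_ge0// ltW.
- by apply: ge0_ler_powR; rewrite ?nnegrE ?ltW// dyadic_gt0.
Qed.

End dyadic_layers.

(** * Sub-sigma-algebras *)

Definition superlevel (T : Type) (R : realType) (A : T -> R) (t : R) : set T :=
  [set x | t < A x].

Section sub_sigma_algebra.
Context (d : measure_display) (T : measurableType d) (R : realType).
Variable mu : {measure set T -> \bar R}.
Implicit Types (G : set (set T)) (E : set T) (f g u v : T -> R).

Record sigma_finite_sub G : Prop := {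
  sub_sigma_algebra : sigma_algebra [set: T] G ;
  sub_measurable : G `<=` measurable ;
  sub_sigma_finite : exists2 A : (set T)^nat,
    [set: T] = \bigcup_n A n & forall n, G (A n) /\ (mu (A n) < +oo)%E }.

Lemma integral_le_lim (g : nat -> T -> \bar R) (l : T -> \bar R) (c : \bar R) :
  (forall n, measurable_fun [set: T] (g n)) -> (forall n x, (0 <= g n x)%E) ->
  (forall x, nondecreasing_seq (g ^~ x)) -> (forall x, g n x @[n --> \oo] --> l x) ->
  (forall n, (\int[mu]_x g n x <= c)%E) -> (\int[mu]_x l x <= c)%E.
Proof.
move=> mg g0 ndg gl gc.
rewrite (_ : l = fun x => limn (g ^~ x)); last first.
  by apply/funext => x; apply/esym/cvg_lim.
rewrite monotone_convergence//.
apply: lime_le; last exact: nearW.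
apply: ereal_nondecreasing_is_cvgn => m n mn.
by apply: ge0_le_integral => // x _; exact: ndg.
Qed.

Lemma integral_indicM E u : measurable E ->
  (\int[mu]_x (\1_E x * u x)%:E = \int[mu]_(x in E) (u x)%:E)%E.
Proof.
move=> mE; rewrite [RHS]integral_mkcond; apply: eq_integral => x _.
by rewrite patchE indicE; case: ifPn => _; rewrite ?mul1r ?mul0r.
Qed.

Section one_algebra.
Variables (G : set (set T)) (sG : sigma_finite_sub G).
Local Notation S := (g_sigma_algebraType G).

Lemma measurable_subE : @measurable _ S = G.
Proof. exact: measurable_g_measurableTypeE (sub_sigma_algebra sG). Qed.

(** Viewing [T] as a second measurable type, whose measurable sets are those of
[G], makes the closure properties of measurable functions available for [G]. *)
Lemma measurable_wrtE f :
  measurable_wrt G f <-> measurable_fun [set: S] (f : S -> R).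
Proof.
split=> [mf _ B mB|mf B mB]; first by rewrite setTI measurable_subE; exact: mf.
by rewrite -measurable_subE -[X in measurable X](setTI (f @^-1` B)); exact: mf.
Qed.

Lemma measurable_wrt_fun f : measurable_wrt G f -> measurable_fun [set: T] f.
Proof. by move=> mf _ B mB; rewrite setTI; exact/(sub_measurable sG)/mf. Qed.

Lemma measurable_wrtM f g : measurable_wrt G f -> measurable_wrt G g ->
  measurable_wrt G (fun x => f x * g x).
Proof. by move=> /measurable_wrtE ? /measurable_wrtE ?; apply/measurable_wrtE/measurable_funM. Qed.

Lemma measurable_wrt_indic E : G E -> measurable_wrt G (\1_E : T -> R).
Proof. by move=> GE; apply/measurable_wrtE/measurable_indic; rewrite measurable_subE. Qed.

Lemma measurable_wrt_pos_part f :
  measurable_wrt G f -> measurable_wrt G (fun x => Num.max 0 (f x)).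
Proof. by move=> /measurable_wrtE ?; apply/measurable_wrtE/measurable_maxr. Qed.

Lemma measurable_wrtV f : (forall x, 0 <= f x) ->
  measurable_wrt G f -> measurable_wrt G (fun x => (f x)^-1).
Proof.
move=> f0 /measurable_wrtE mf; apply/measurable_wrtE.
rewrite (_ : (fun _ => _) = fun x => f x `^ (-1)).
  exact: (measurableT_comp (measurable_powR _) mf).
by apply/funext => x; rewrite powR_inv1.
Qed.

Lemma sub_setI E E' : G E -> G E' -> G (E `&` E').
Proof. by rewrite -measurable_subE; exact: measurableI. Qed.

Lemma sub_setD E E' : G E -> G E' -> G (E `\` E').
Proof. by rewrite -measurable_subE; exact: measurableD. Qed.

Lemma sub_superlevel f (t : R) : measurable_wrt G f -> G (superlevel f t).
Proof.
move=> mf; rewrite (_ : superlevel f t = f @^-1` `]t, +oo[%classic).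
  by apply: mf; exact: measurable_itv.
by apply/seteqP; split=> x /=; rewrite in_itv/= andbT.
Qed.

Lemma sub_eq f (t : R) : measurable_wrt G f -> G [set x | f x = t].
Proof. by move=> mf; exact: (mf [set t] (measurable_set1 t)). Qed.

Lemma finite_exhaustion : exists B : (set T)^nat,
  [/\ forall n, finite_part mu G (B n), nondecreasing_seq B & \bigcup_n B n = setT].
Proof.
have [A AT GA] := sub_sigma_finite sG.
have mA n : (measurable : set (set S)) (A n) by rewrite measurable_subE; case: (GA n).
exists (fun n => \big[setU/set0]_(i < n.+1) A i); split.
- move=> n; split; first by rewrite -measurable_subE; exact: bigsetU_measurable.
  apply: (@le_lt_trans _ _ (\sum_(i < n.+1) mu (A i))%E).
    by apply: Boole_inequality => k _; apply: (sub_measurable sG); case: (GA k).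
  by apply: lte_sum_pinfty => i _; case: (GA i).
- by move=> m n mn; apply/subsetPset/subset_bigsetU.
- by rewrite bigcup_bigsetU_bigcup -AT.
Qed.

(** By sigma-finiteness [E] is an increasing union of sets of finite measure in
[G], and integrals over them converge. *)
Lemma integral_le_finite_part E (u : T -> \bar R) (c : \bar R) : G E ->
  measurable_fun [set: T] u -> (forall x, (0 <= u x)%E) ->
  (forall E', finite_part mu G E' -> E' `<=` E -> (\int[mu]_(x in E') u x <= c)%E) ->
  (\int[mu]_(x in E) u x <= c)%E.
Proof.
move=> GE mu_ u0 uc; have [B [fB ndB UB]] := finite_exhaustion.
have mEB n : measurable (E `&` B n).
  by apply: (sub_measurable sG); apply: sub_setI => //; case: (fB n).
have -> : E = \bigcup_n (E `&` B n) by rewrite -setI_bigcupr UB setIT.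
have cv : (\int[mu]_(x in E `&` B n) u x)%E @[n --> \oo] -->
    (\int[mu]_(x in \bigcup_n (E `&` B n)) u x)%E.
  apply: ge0_nondecreasing_set_cvg_integral => //.
  - by move=> m n /ndB; rewrite !subsetEset => BB; exact: setIS.
  - by move=> n; exact: measurable_funTS.
rewrite -(cvg_lim _ cv)//; apply: lime_le; first by apply/cvg_ex; eexists; exact: cv.
apply: nearW => n; apply: uc; last exact: subIsetl.
split; first by apply: sub_setI => //; case: (fB n).
apply: le_lt_trans (proj2 (fB n)); apply: le_measure; rewrite ?inE//.
by apply: (sub_measurable sG); case: (fB n).
Qed.

Import HBNNSimple.

(** Approximating [h] by simple functions with level sets in [G] reduces the
comparison to integrals over sets of [G], and these are exhausted by sets of
finite measure. *)
Lemma le_integralM u v : measurable_fun [set: T] u -> measurable_fun [set: T] v ->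
  (forall x, 0 <= u x) -> (forall x, 0 <= v x) ->
  (forall E, finite_part mu G E ->
    (\int[mu]_(x in E) (u x)%:E <= \int[mu]_(x in E) (v x)%:E)%E) ->
  forall h, (forall x, 0 <= h x) -> measurable_wrt G h ->
  (\int[mu]_x (h x * u x)%:E <= \int[mu]_x (h x * v x)%:E)%E.
Proof.
move=> mu_ mv u0 v0 uv h h0 mh.
have {}uv E : G E -> (\int[mu]_(x in E) (u x)%:E <= \int[mu]_(x in E) (v x)%:E)%E.
  move=> GE; apply: integral_le_finite_part => //; first exact/measurable_EFinP.
  move=> E' fE' E'E; apply: le_trans (uv _ fE') _.
  apply: ge0_subset_integral => //.
  - by apply: (sub_measurable sG); case: fE'.
  - exact: (sub_measurable sG).
  - by apply/measurable_funTS/measurable_EFinP.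
  - by move=> x _; rewrite lee_fin.
have mhS : measurable_fun [set: S] (EFin \o h : S -> \bar R).
  exact/measurable_EFinP/measurable_wrtE.
pose k := nnsfun_approx (@measurableT _ S) mhS.
have mk n : measurable_wrt G (k n) by apply/measurable_wrtE; exact: measurable_funP.
have h0S (x : S) : [set: S] x -> (0 <= (EFin \o h : S -> \bar R) x)%E.
  by move=> _; rewrite lee_fin.
have k0 n x : 0 <= k n x by [].
have ndk x : nondecreasing_seq (fun n => k n x).
  by move=> m n mn; exact/lefP/nd_nnsfun_approx.
have cvk x : (k n x)%:E @[n --> \oo] --> (h x)%:E.
  exact: (cvg_nnsfun_approx _ mhS h0S).
have kh x n : k n x <= h x.
  rewrite -lee_fin -(cvg_lim _ (cvk x))//.
  apply: lime_ge; first by apply/cvg_ex; eexists; exact: cvk.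
  by exists n => // m /= nm; rewrite lee_fin; exact: ndk.
have mM g g' : measurable_wrt G g -> measurable_fun [set: T] g' ->
    measurable_fun [set: T] (fun x => (g x * g' x)%:E).
  by move=> mg mg'; apply/measurable_EFinP/measurable_funM => //; exact/measurable_wrt_fun.
have simpleE n g : measurable_fun [set: T] g -> (forall x, 0 <= g x) ->
    (\int[mu]_x (k n x * g x)%:E =
     \sum_(y \in range (k n)) y%:E * \int[mu]_(x in k n @^-1` [set y]) (g x)%:E)%E.
  move=> mg g0.
  have Gy y : G (k n @^-1` [set y]) by exact: mk.
  have term0 y x : (0 <= (y * (\1_(k n @^-1` [set y]) x * g x))%:E)%E.
    rewrite lee_fin indicE; case: (boolP (x \in _)); rewrite ?mul0r ?mulr0 ?mul1r//.
    by rewrite inE => /= <-; rewrite mulr_ge0.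
  have mi y : measurable_fun [set: T] (fun x => \1_(k n @^-1` [set y]) x * g x).
    apply/measurable_funM => //; apply: measurable_indic.
    exact: (sub_measurable sG).
  transitivity (\int[mu]_x (\sum_(y \in range (k n))
      (y * (\1_(k n @^-1` [set y]) x * g x))%:E))%E.
    apply: eq_integral => x _.
    rewrite fsumEFin// {1}(fimfunE (k n) x) !fsbig_finite// mulr_suml.
    by congr (_%:E); apply: eq_bigr => y _; rewrite mulrA.
  rewrite ge0_integral_fsum//; last first.
    by move=> y; apply/measurable_EFinP/measurable_funM.
  apply: eq_fsbigr => y /[!inE] -[x0 _ kx0].
  under eq_integral do rewrite EFinM.
  rewrite ge0_integralZl_EFin//.
  - by rewrite integral_indicM//; exact: (sub_measurable sG).
  - by move=> x _; rewrite lee_fin mulr_ge0.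
  - exact/measurable_EFinP.
  - by rewrite -kx0.
have simple n : (\int[mu]_x (k n x * u x)%:E <= \int[mu]_x (k n x * v x)%:E)%E.
  rewrite !simpleE//; apply: lee_fsum => // y [x0 _ <-].
  apply: lee_wpmul2l; first by rewrite lee_fin.
  by apply: uv; exact: mk.
apply: (@integral_le_lim (fun n x => (k n x * u x)%:E)).
- by move=> n; exact: mM.
- by move=> n x; rewrite lee_fin mulr_ge0.
- by move=> x m n mn; rewrite lee_fin ler_wpM2r//; exact: ndk.
- move=> x; have fu : (u x)%:E \is a fin_num by [].
  by have /= := cvgeZr fu (cvk x).
- move=> n; apply: le_trans (simple n) _.
  apply: ge0_le_integral => //.
  + by move=> x _; rewrite lee_fin mulr_ge0.
  + exact: mM.
  + exact: mM.
  + by move=> x _; rewrite lee_fin ler_wpM2r.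
Qed.
End one_algebra.
End sub_sigma_algebra.

(** * Conditional expectation of nonnegative functions *)

Section radon_nikodym_sub.
Context (d : measure_display) (T : measurableType d) (R : realType).
Variables (mu : {measure set T -> \bar R}) (G : set (set T)).
Hypothesis sG : sigma_finite_sub mu G.
Local Notation S := (g_sigma_algebraType G).
Local Open Scope ereal_scope.

Let mS (E : set S) : measurable E -> @measurable _ T E.
Proof. by rewrite (measurable_subE sG); exact: (sub_measurable sG). Qed.

Let muS : set S -> \bar R := pushforward mu (idfun : T -> S).

Let mid : measurable_fun [set: T] (idfun : T -> S).
Proof. by move=> _ B mB; rewrite setTI; exact: mS. Qed.

Let muS0 : muS set0 = 0. Proof. exact: measure0. Qed.
Let muS_ge0 E : 0 <= muS E. Proof. exact: measure_ge0. Qed.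
Let muS_sigma : semi_sigma_additive muS.
Proof.
move=> F mF tF mUF; apply: (@measure_semi_sigma_additive _ _ _ mu) => //.
  by move=> n; exact: (mS (mF n)).
exact: (mS mUF).
Qed.
HB.instance Definition _ := isMeasure.Build _ _ _ muS muS0 muS_ge0 muS_sigma.

Let muS_sigma_finite : sigma_finite [set: S] muS.
Proof.
have [A AT GA] := sub_sigma_finite sG.
by exists A => // n; rewrite (measurable_subE sG); exact: GA.
Qed.
HB.instance Definition _ := Measure_isSigmaFinite.Build _ _ _ muS muS_sigma_finite.

Variable u : T -> \bar R.
Hypotheses (mu_ : measurable_fun [set: T] u) (u0 : forall x, 0 <= u x)
  (intu : \int[mu]_x u x < +oo).

Let nu : set S -> \bar R := fun E => \int[mu]_(x in E) u x.
Let nu0 : nu set0 = 0. Proof. exact: integral_set0. Qed.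
Let nu_ge0 E : 0 <= nu E. Proof. by apply: integral_ge0. Qed.
Let nu_sigma : semi_sigma_additive nu.
Proof.
move=> F mF tF mUF; apply: (semi_sigma_additive_nng_induced mu_ u0) => //.
  by move=> n; exact: (mS (mF n)).
exact: (mS mUF).
Qed.
HB.instance Definition _ := isMeasure.Build _ _ _ nu nu0 nu_ge0 nu_sigma.

Let nu_fin : fin_num_fun nu.
Proof.
move=> E mE; rewrite ge0_fin_numE; last exact: nu_ge0.
by apply: le_lt_trans intu; apply: ge0_subset_integral => //; exact: mS.
Qed.
HB.instance Definition _ := Measure_isFinite.Build _ _ _ nu nu_fin.

(** The Radon-Nikodym theorem on the space whose measurable sets are those of
[G], where [u mu] is a finite measure dominated by [mu]. *)
Lemma radon_nikodym_sub : exists g : T -> \bar R,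
  [/\ measurable_fun [set: S] (g : S -> \bar R), forall x, 0 <= g x &
      forall E, G E -> \int[mu]_(x in E) g x = \int[mu]_(x in E) u x].
Proof.
have numu : nu `<< muS.
  apply/null_content_dominatesP => A mA muA.
  by apply: null_set_integral => //; [exact: mS|exact: measurable_funTS].
have [g [g0 _ ig gE]] := radon_nikodym_sigma_finite numu.
have mg := measurable_int _ ig.
exists g; split => // E GE.
have mE : @measurable _ S E by rewrite (measurable_subE sG).
have /= := gE _ mE; rewrite /nu => ->.
rewrite (ge0_integral_pushforward mid)//.
exact: measurable_funTS.
Qed.

End radon_nikodym_sub.

Section conditional_expectation.
Context (d : measure_display) (T : measurableType d) (R : realType).
Variables (mu : {measure set T -> \bar R}) (G : set (set T)).
Hypothesis sG : sigma_finite_sub mu G.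
Local Notation S := (g_sigma_algebraType G).
Implicit Types f g h : T -> R.

Definition nonneg_integrable f := [/\ measurable_fun [set: T] f, forall x, 0 <= f x &
  forall E, finite_part mu G E -> mu.-integrable E (EFin \o f)].

(** [f mu] is only sigma-finite on [G]. The densities on the pieces of a countable
partition into sets of finite measure add up to a density of the whole, which
is finite almost everywhere on sets of finite measure, so that passing to real
values changes no integral. *)
Lemma ex_cond_exp f : nonneg_integrable f -> exists h, is_cond_exp mu G f h.
Proof.
move=> [mf f0 intf].
have [A AT GA] := sub_sigma_finite sG; pose B := seqDU A.
have GB n : finite_part mu G (B n).
  split.
    rewrite -(measurable_subE sG); apply: seqDU_measurable => k.
    by rewrite (measurable_subE sG); case: (GA k).
  apply: le_lt_trans (proj2 (GA n)); apply: le_measure; rewrite ?inE.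
  - apply: seqDU_measurable => k.
    by apply: (sub_measurable sG); case: (GA k).
  - by apply: (sub_measurable sG); case: (GA n).
  - exact: subset_seqDU.
have mB n : measurable (B n) by apply: (sub_measurable sG); case: (GB n).
have mfB n : measurable_fun [set: T] (fun x => (\1_(B n) x * f x)%:E).
  by apply/measurable_EFinP/measurable_funM.
have fB0 n x : (0 <= (\1_(B n) x * f x)%:E)%E by rewrite lee_fin mulr_ge0.
have intB n : (\int[mu]_x (\1_(B n) x * f x)%:E < +oo)%E.
  rewrite integral_indicM//; have /integrableP[_] := intf _ (GB n).
  by under eq_integral do rewrite /= ger0_norm//.
have /choice[g gP] : forall n, exists g : T -> \bar R,
  [/\ measurable_fun [set: S] (g : S -> \bar R), forall x, (0 <= g x)%E &
      forall E, G E -> (\int[mu]_(x in E) g x =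
        \int[mu]_(x in E) (\1_(B n) x * f x)%:E)%E].
  by move=> n; exact: (radon_nikodym_sub sG (mfB n) (fB0 n) (intB n)).
pose H x := (\sum_(n <oo) g n x)%E.
have mHS : measurable_fun [set: S] (H : S -> \bar R).
  by apply: ge0_emeasurable_sum => // n *; case: (gP n).
have subfun (k : T -> \bar R) : measurable_fun [set: S] (k : S -> \bar R) ->
    measurable_fun [set: T] k.
  move=> mk _ C mC; apply: (sub_measurable sG); rewrite -(measurable_subE sG).
  exact: mk.
have H0 x : (0 <= H x)%E by apply: nneseries_ge0 => n *; case: (gP n).
have HE E : G E -> (\int[mu]_(x in E) H x = \int[mu]_(x in E) (f x)%:E)%E.
  move=> GE; have mE := sub_measurable sG GE.
  rewrite integral_nneseries//; last 2 first.
  - by move=> n; apply: measurable_funTS; apply: subfun; case: (gP n).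
  - by move=> n x _; case: (gP n).
  under eq_eseriesr => n _ do (case: (gP n) => _ _ ->//).
  rewrite -integral_nneseries//; last by move=> n; exact: measurable_funTS.
  apply: eq_integral => x _.
  have [n _ Bnx] : (\bigcup_n B n) x by rewrite -seqDU_bigcup_eq -AT.
  rewrite (@nneseriesD1 _ _ n)// indicE mem_set// mul1r eseries0 ?adde0//.
  move=> m _ /eqP mn; rewrite indicE memNset ?mul0r// => Bmx.
  by apply: mn; apply: (trivIset_seqDU A) => //; exists x.
have Hfin E : finite_part mu G E -> mu.-integrable E H.
  move=> fE; have [GE _] := fE; apply/integrableP; split.
    exact/measurable_funTS/subfun.
  under eq_integral do rewrite gee0_abs//.
  rewrite HE//; have /integrableP[_] := intf _ fE.
  by under eq_integral do rewrite /= ger0_norm//.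
exists (fine \o H); split.
- apply/(measurable_wrtE sG).
  by apply: measurableT_comp => //.
- move=> E fE; have mE := sub_measurable sG fE.1.
  apply: (le_integrable mE _ _ (Hfin _ fE)).
    apply/measurable_EFinP/measurable_funTS; apply: measurableT_comp => //.
    exact: subfun.
  move=> x _ /=; rewrite gee0_abs//; have := H0 x; case: (H x) => //= [r r0|_].
    by rewrite ger0_norm.
  by rewrite leey.
- move=> E fE; have mE := sub_measurable sG fE.1.
  rewrite -HE ?fE.1//; last by case: fE.
  apply: ge0_ae_eq_integral => //.
  + apply/measurable_EFinP/measurable_funTS; apply: measurableT_comp => //.
    exact: subfun.
  + exact/measurable_funTS/subfun.
  + by move=> x _; rewrite lee_fin fine_ge0.
  + by have := integrable_ae mE (Hfin _ fE); apply: filterS => x /[apply] /fineK.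
Qed.

Lemma cond_expP f : nonneg_integrable f -> is_cond_exp mu G f (cond_exp mu G f).
Proof. by move=> /ex_cond_exp; exact: xgetPex. Qed.

(** The chosen version of the conditional expectation of a nonnegative function
can be negative on a null set; the positive part is again a version. *)
Definition pcond_exp f x := Num.max 0 (cond_exp mu G f x).

Lemma pcond_exp_ge0 f x : 0 <= pcond_exp f x.
Proof. by rewrite le_max lexx. Qed.

Lemma measurable_wrt_pcond_exp f : nonneg_integrable f -> measurable_wrt G (pcond_exp f).
Proof. by move=> /cond_expP[? _ _]; exact: (measurable_wrt_pos_part sG). Qed.

(** On the part of a set of finite measure where the conditional expectation is
negative, its integral equals that of [f], hence is nonnegative; so that part
is a null set. *)
Lemma ae_pcond_exp f : nonneg_integrable f ->
  {ae mu, forall x, cond_exp mu G f x = pcond_exp f x}.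
Proof.
move=> nf; have [mh inth hE] := cond_expP nf; have [mf f0 intf] := nf.
have [A AT GA] := sub_sigma_finite sG.
have {}GA n : finite_part mu G (A n) by exact: GA.
have An n : {ae mu, forall x, A n x -> 0 <= cond_exp mu G f x}.
  set h := cond_exp mu G f; pose E := A n `&` [set x | h x < 0].
  have GE : G E.
    apply: (sub_setI sG); first by case: (GA n).
    rewrite (_ : [set x | _] = h @^-1` `]-oo, 0[%classic).
      by apply: mh; exact: measurable_itv.
    by apply/seteqP; split=> x /=; rewrite in_itv.
  have mE := sub_measurable sG GE.
  have fE : finite_part mu G E.
    split => //; apply: le_lt_trans (GA n).2; apply: le_measure; rewrite ?inE//.
      by apply: (sub_measurable sG); case: (GA n).
    exact: subIsetl.
  have /(ae_eq_integral_abs mu mE)/= : (\int[mu]_(x in E) `|(h x)%:E| = 0)%E.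
    have hN : (\int[mu]_(x in E) (h x)%:E = - \int[mu]_(x in E) `|(h x)%:E|)%E.
      rewrite -integral_ge0N//; apply: eq_integral => x /[!inE] -[_ /= hx].
      by rewrite ltr0_norm// opprK.
    apply/eqP; rewrite eq_le integral_ge0// andbT -oppe_ge0 -hN hE//.
    by apply: integral_ge0 => x _; rewrite lee_fin.
  have mhE : measurable_fun E (EFin \o h).
    by apply/measurable_EFinP/measurable_funTS/(measurable_wrt_fun sG).
  move=> /(_ mhE); apply: filterS => x /= hx Anx; rewrite leNgt; apply/negP => hlt.
  by have [h0] := hx (conj Anx hlt); rewrite h0 ltxx in hlt.
have := ae_foralln An.
apply: filterS => x Ax; apply/esym/max_idPr.
have [n _ Anx] : (\bigcup_n A n) x by rewrite -AT.
exact: (Ax n).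
Qed.

(** The pull-out property, in integrated form: both sides agree when [h] is the
indicator of a set of finite measure in [G]. *)
Lemma integral_pcond_exp f h : nonneg_integrable f ->
  (forall x, 0 <= h x) -> measurable_wrt G h ->
  (\int[mu]_x (h x * pcond_exp f x)%:E = \int[mu]_x (h x * f x)%:E)%E.
Proof.
move=> nf h0 mh; have [mg intg gE] := cond_expP nf; have [mf f0 intf] := nf.
have mp := measurable_wrt_fun sG (measurable_wrt_pcond_exp nf).
have pE E : finite_part mu G E ->
    (\int[mu]_(x in E) (pcond_exp f x)%:E = \int[mu]_(x in E) (f x)%:E)%E.
  move=> fE; rewrite -gE//; apply: ae_eq_integral.
  - by apply: (sub_measurable sG); case: fE.
  - exact/measurable_funTS/measurable_EFinP.
  - exact/measurable_funTS/measurable_EFinP/(measurable_wrt_fun sG).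
  - by apply: filterS (ae_pcond_exp nf) => x ->.
have p0 := pcond_exp_ge0 f.
apply/eqP; rewrite eq_le; apply/andP; split;
  by apply: (le_integralM sG) => // E fE; rewrite pE.
Qed.

End conditional_expectation.

(** * Integrals against a weight *)

Section weighted_integrals.
Context (d : measure_display) (T : measurableType d) (R : realType).
Variable mu : {measure set T -> \bar R}.
Implicit Types (u v w A : T -> R) (s t c : R).

(** Hoelder's inequality for the measure [w mu], as the inequality for [mu]
applied to [u w^(1/a)] and [v w^(1/b)]. *)
Lemma weighted_hoelder u v w (a b : R) :
  measurable_fun [set: T] u -> measurable_fun [set: T] v ->
  measurable_fun [set: T] w ->
  (forall x, 0 <= u x) -> (forall x, 0 <= v x) -> (forall x, 0 <= w x) ->
  0 < a -> 0 < b -> a^-1 + b^-1 = 1 ->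
  (\int[mu]_x (u x * v x * w x)%:E <=
   (\int[mu]_x (u x `^ a * w x)%:E) `^ a^-1 *
   (\int[mu]_x (v x `^ b * w x)%:E) `^ b^-1)%E.
Proof.
move=> mu_ mv mw u0 v0 w0 a0 b0 ab.
have mpow (r : R) : measurable_fun [set: T] (fun x => w x `^ r).
  exact: (measurableT_comp (measurable_powR _) mw).
have normE (z : T -> R) (r : R) : (forall x, 0 <= z x) -> 0 < r ->
    ('N[mu]_(r%:E)[EFin \o (fun x => (z x * w x `^ r^-1)%R)] =
     (\int[mu]_x (z x `^ r * w x)%:E) `^ r^-1)%E.
  move=> z0 r0; rewrite unlock; congr (_ `^ _)%E; apply: eq_integral => x _ /=.
  rewrite ger0_norm ?mulr_ge0 ?powR_ge0// powRM ?powR_ge0//.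
  by rewrite -powRrM mulVf ?gt_eqF// powRr1.
rewrite -(normE u a u0 a0) -(normE v b v0 b0).
apply: le_trans (hoelder mu _ _ a0 b0 ab).
- rewrite Lnorm1; apply: eq_lee; apply: eq_integral => x _ /=.
  rewrite ger0_norm ?mulr_ge0 ?powR_ge0// mulrACA -powRD; last first.
    by rewrite ab oner_eq0.
  by rewrite ab powRr1.
- exact: measurable_funM.
- exact: measurable_funM.
Qed.

Lemma measurable_level A t : measurable_fun [set: T] A -> measurable (superlevel A t).
Proof.
move=> mA; rewrite -[X in measurable X]setTI.
rewrite (_ : superlevel A t = A @^-1` `]t, +oo[%classic).
  by apply: mA => //; exact: measurable_itv.
by apply/seteqP; split=> x /=; rewrite in_itv/= andbT.
Qed.

Lemma indic_superlevel A t x : \1_(superlevel A t) x = (t < A x)%R%:R :> R.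
Proof.
by rewrite indicE; congr ((nat_of_bool _)%:R); apply/idP/idP; rewrite inE.
Qed.

Lemma integral_levelE A v t : measurable_fun [set: T] A ->
  (\int[mu]_(x in superlevel A t) (v x)%:E =
   \int[mu]_x ((t < A x)%R%:R * v x)%:E)%E.
Proof.
move=> mA; rewrite -integral_indicM; last exact: measurable_level.
by apply: eq_integral => x _; rewrite indic_superlevel.
Qed.

Section layers.
Variables (A v : T -> R).
Hypotheses (mA : measurable_fun [set: T] A) (mv : measurable_fun [set: T] v).
Hypotheses (A0 : forall x, 0 <= A x) (v0 : forall x, 0 <= v x).

Let layer s (k : int) x : \bar R :=
  (dyadic R k `^ s * (dyadic R k < A x)%R%:R * v x)%:E.

Let mlayer s k : measurable_fun [set: T] (layer s k).
Proof.
apply/measurable_EFinP/measurable_funM => //; apply: measurable_funM => //.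
rewrite (_ : (fun _ => _) = \1_(superlevel A (dyadic R k))).
  exact/measurable_indic/measurable_level.
by apply/funext => x; rewrite indic_superlevel.
Qed.

Let layer_ge0 s k x : (0 <= layer s k x)%E.
Proof. by rewrite lee_fin !mulr_ge0// powR_ge0. Qed.

Let integral_layer s k : (\int[mu]_x layer s k x =
  (dyadic R k `^ s)%:E * \int[mu]_(x in superlevel A (dyadic R k)) (v x)%:E)%E.
Proof.
rewrite integral_levelE// -ge0_integralZl_EFin//.
- by apply: eq_integral => x _; rewrite /layer -mulrA.
- by move=> x _; rewrite lee_fin mulr_ge0.
- have := mlayer 0 k; rewrite /layer; under eq_fun do rewrite powRr0 mul1r.
  exact.
- exact: powR_ge0.
Qed.

(** This lemma and [layers_le_integral_powR] are the layer-cake formula, up to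
constants, for the levels [2^k]. *)
Lemma integral_powR_le_layers s : 0 < s ->
  (\int[mu]_x (A x `^ s * v x)%:E <= (2 `^ s)%:E *
    \esum_(k in [set: int]) ((dyadic R k `^ s)%:E *
      \int[mu]_(x in superlevel A (dyadic R k)) (v x)%:E))%E.
Proof.
move=> s0; under eq_esum do rewrite -integral_layer.
rewrite -integral_esum// -ge0_integralZl_EFin//; last 2 first.
- by move=> x _; apply: esum_ge0 => k _.
- exact: emeasurable_esum.
apply: ge0_le_integral => //.
- by move=> x _; rewrite lee_fin mulr_ge0// powR_ge0.
- apply/measurable_EFinP/measurable_funM => //.
  exact: (measurableT_comp (measurable_powR _) mA).
- by apply: measurable_funeM; exact: emeasurable_esum.
- move=> x _; rewrite EFinM.
  apply: (@le_trans _ _ ((2 `^ s)%:E * (\esum_(k in [set: int])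
    (dyadic R k `^ s * (dyadic R k < A x)%R%:R)%:E) * (v x)%:E)%E).
    by apply: lee_wpmul2r; [rewrite lee_fin|exact: powR_le_dyadic].
  rewrite -muleA; apply: lee_wpmul2l; first by rewrite lee_fin powR_ge0.
  rewrite muleC -esumZl//; last by move=> k; rewrite lee_fin mulr_ge0// powR_ge0.
  by apply: le_esum => k _; rewrite /layer -EFinM mulrC.
Qed.

Lemma integral_le_layers :
  (\int[mu]_x (A x * v x)%:E <= 2%:E * \esum_(k in [set: int])
    ((dyadic R k)%:E * \int[mu]_(x in superlevel A (dyadic R k)) (v x)%:E))%E.
Proof.
have A1 x : A x = A x `^ 1 by rewrite powRr1.
have d1 k : dyadic R k = dyadic R k `^ 1 by rewrite powRr1// ltW// dyadic_gt0.
have two1 : (2 : R) = 2 `^ 1 by rewrite powRr1.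
apply: (@le_trans _ _ (\int[mu]_x (A x `^ 1 * v x)%:E)%E).
  by apply: eq_lee; apply: eq_integral => x _; rewrite -A1.
apply: le_trans (integral_powR_le_layers ltr01) _.
rewrite -two1 (eq_esum (b := fun k => ((dyadic R k)%:E *
    \int[mu]_(x in superlevel A (dyadic R k)) (v x)%:E)%E)) => [|k _].
  exact: lexx.
by rewrite -d1.
Qed.

Lemma layers_le_integral_powR s c : dyadic_bound s c ->
  (\esum_(k in [set: int]) ((dyadic R k `^ s)%:E *
      \int[mu]_(x in superlevel A (dyadic R k)) (v x)%:E) <=
   c%:E * \int[mu]_x (A x `^ s * v x)%:E)%E.
Proof.
move=> [/ltW c0 hc]; under eq_esum do rewrite -integral_layer.
have mAs : measurable_fun [set: T] (fun x => (A x `^ s * v x)%:E).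
  apply/measurable_EFinP/measurable_funM => //.
  exact: (measurableT_comp (measurable_powR _) mA).
have As0 x : (0 <= (A x `^ s * v x)%:E)%E by rewrite lee_fin mulr_ge0// powR_ge0.
rewrite -integral_esum// -ge0_integralZl_EFin//.
apply: ge0_le_integral => //.
- by move=> x _; apply: esum_ge0 => k _.
- exact: emeasurable_esum.
- exact: measurable_funeM.
- move=> x _; rewrite /layer; under eq_esum do rewrite mulrC EFinM.
  rewrite esumZl//; last by move=> k; rewrite lee_fin mulr_ge0// powR_ge0.
  rewrite -EFinM mulrA mulrC EFinM.
  by apply: lee_wpmul2l; [rewrite lee_fin|exact: hc].
Qed.

End layers.

Lemma weighted_chebyshev A w s t : measurable_fun [set: T] A ->
  measurable_fun [set: T] w -> (forall x, 0 <= A x) -> (forall x, 0 <= w x) ->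
  0 < s -> 0 < t ->
  ((t `^ s)%:E * wmass mu w (superlevel A t) <= \int[mu]_x (A x `^ s * w x)%:E)%E.
Proof.
move=> mA mw A0 w0 s0 t0; rewrite /wmass.
have mE := measurable_level t mA.
rewrite -ge0_integralZl_EFin; last 4 first.
- exact: mE.
- by move=> x _; rewrite lee_fin.
- exact/measurable_funTS/measurable_EFinP.
- exact: powR_ge0.
have mAs : measurable_fun [set: T] (fun x => (A x `^ s * w x)%:E).
  apply/measurable_EFinP/measurable_funM => //.
  exact: (measurableT_comp (measurable_powR _) mA).
apply: (@le_trans _ _ (\int[mu]_(x in superlevel A t) (A x `^ s * w x)%:E)%E).
  apply: ge0_le_integral => //.
  - by move=> x _; rewrite lee_fin mulr_ge0// powR_ge0.
  - by apply: measurable_funeM; exact/measurable_funTS/measurable_EFinP.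
  - exact: measurable_funTS.
  - move=> x /= /ltW tA; rewrite -EFinM lee_fin ler_wpM2r//.
    by apply: ge0_ler_powR => //; rewrite ?nnegrE// ltW.
apply: ge0_subset_integral => //.
by move=> x _; rewrite lee_fin mulr_ge0// powR_ge0.
Qed.

End weighted_integrals.

(** * Powers of nonnegative extended reals *)

Lemma ge0_le_poweR (R : realType) (r : R) (x y : \bar R) : 0 <= r ->
  (0 <= x)%E -> (x <= y)%E -> (x `^ r <= y `^ r)%E.
Proof.
move=> r0 x0 xy; apply: gt0_ler_poweR => //; rewrite in_itv/= leey andbT//.
exact: le_trans xy.
Qed.

Lemma poweR1D (R : realType) (r : R) (x : \bar R) : 0 <= r -> (0 <= x)%E ->
  (x `^ (1 + r) = x * x `^ r)%E.
Proof.
move=> r0 x0; rewrite poweRD ?poweRe1//.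
by rewrite /poweRD_def gt_eqF// ltr_wpDr.
Qed.

(** The hypothesis is Chebyshev's inequality for the exponent [1 / (1 + g)].
Used for the factor [X^g] of [X^(1 + g)], it leaves an expression linear in [X],
which can be summed over the levels [t]. *)
Lemma stopped_layer (R : realType) (t C g N : R) (X : \bar R) :
  0 < t -> 0 <= C -> 0 <= g -> 0 <= N -> (0 <= X)%E ->
  ((t `^ (1 + g)^-1)%:E * X <= N%:E)%E ->
  (t%:E * (C%:E * X `^ (1 + g)) <=
   (C * N `^ g)%:E * ((t `^ (1 + g)^-1)%:E * X))%E.
Proof.
move=> t0 C0 g0 N0; have g1 : 0 < 1 + g by rewrite ltr_wpDr.
have tr : 0 < t `^ (1 + g)^-1 by exact: powR_gt0.
case: X => [X| |]//; last first.
  by move=> _; rewrite gt0_muley ?lte_fin// leye_eq.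
rewrite poweR_EFin -!EFinM !lee_fin => X0 XN; rewrite powRD; last first.
  by rewrite gt_eqF.
rewrite powRr1//.
have -> : t * (C * (X * X `^ g)) = C * X * (t * X `^ g) by ring.
set s := t `^ _ in tr XN *.
have -> : C * N `^ g * (s * X) = C * X * (s * N `^ g) by ring.
apply: ler_wpM2l; first exact: mulr_ge0.
have tE : t = s * s `^ g.
  rewrite /s -powRrM -powRD; last by rewrite (gt_eqF t0) implybT.
  by rewrite -[X in X + _]mulr1 -mulrDr mulVf ?gt_eqF// powRr1// ltW.
rewrite {1}tE -mulrA; apply: ler_wpM2l; first exact: ltW.
rewrite -powRM//; last exact: ltW.
by apply: ge0_ler_powR => //; rewrite nnegrE// mulr_ge0// ltW.
Qed.

(** Collects the exponents after Hoelder's inequality has bounded the integral [N]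
of a power of a product, and maximal inequalities have bounded [X] and [Y]. *)
Lemma poweR_mul_bound (R : realType) (p s g : R) (N X Y A B : \bar R) :
  0 <= g -> 0 < p -> 0 < s -> (0 <= N)%E -> (0 <= X)%E -> (0 <= Y)%E ->
  (N <= X `^ ((1 + g)^-1 / p) * Y `^ ((1 + g)^-1 / s))%E ->
  (X <= A)%E -> (Y <= B)%E -> (A < +oo)%E -> (B < +oo)%E ->
  (N < +oo)%E /\ (N `^ (1 + g) <= A `^ p^-1 * B `^ s^-1)%E.
Proof.
move=> g0 p0 s0 N0 X0 Y0 NXY XA YB Aoo Boo.
have g1 : 0 < 1 + g by rewrite ltr_wpDr.
have fin_pow (x : \bar R) (t : R) : (0 <= x)%E -> (x < +oo)%E -> (x `^ t < +oo)%E.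
  by case: x => // x _ _; rewrite ltry.
split.
  apply: (le_lt_trans NXY); apply: lte_mul_pinfty; first exact: poweR_ge0.
    rewrite ge0_fin_numE; first by apply: fin_pow => //; exact: le_lt_trans Aoo.
    exact: poweR_ge0.
  by apply: fin_pow => //; exact: le_lt_trans Boo.
apply: le_trans (ge0_le_poweR (ltW g1) N0 NXY) _.
rewrite poweRM ?poweR_ge0// -!poweRrM.
have rK (t : R) : (1 + g)^-1 / t * (1 + g) = t^-1.
  by rewrite mulrAC mulVf ?mul1r ?gt_eqF.
rewrite !rK; apply: lee_pmul; rewrite ?poweR_ge0//;
  by apply: ge0_le_poweR => //; rewrite invr_ge0 ltW.
Qed.

(** The absorption step of a duality argument; finiteness of [x] allows the
division by [x^(1/r')]. *)
Lemma le_poweR_self (R : realType) (r r' : R) (x D : \bar R) : 0 < r ->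
  r^-1 + r'^-1 = 1 -> (0 <= x)%E -> (x < +oo)%E -> (0 <= D)%E ->
  (x <= D * x `^ r'^-1)%E -> (x <= D `^ r)%E.
Proof.
move=> r0 rr'; case: x => // x x0 _; case: D => // [D|] D0; last first.
  by move=> _; rewrite /= gt_eqF// leey.
rewrite !poweR_EFin -EFinM !lee_fin in x0 D0 *.
move: x0; rewrite le_eqVlt => /predU1P[<-|x0 H]; first by rewrite powR_ge0.
have xr : x `^ r^-1 <= D.
  rewrite -(ler_pM2r (powR_gt0 r'^-1 x0)) -powRD; last by rewrite rr' oner_eq0.
  by rewrite rr' powRr1// ltW.
rewrite -[x](powRr1 (ltW x0)) -(@mulVf _ r) ?gt_eqF// powRrM.
by apply: ge0_ler_powR; rewrite ?nnegrE ?powR_ge0// ltW.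
Qed.

Lemma cvg_truncation (R : realType) (r v : R) (S : \bar R) : 0 < r -> 0 <= v ->
  (0 <= S)%E ->
  (fine (mine S n%:R%:E) `^ r * v)%:E @[n --> \oo] --> (S `^ r * v%:E)%E.
Proof.
move=> r0; rewrite le_eqVlt => /predU1P[<- _|v0].
  rewrite mule0 (_ : (fun _ => _) = cst 0%E); first exact: cvg_cst.
  by apply/funext => n; rewrite mulr0.
case: S => // [s|] S0.
  apply: cvg_near_cst; near=> n.
  rewrite min_l ?poweR_EFin//.
  by rewrite lee_fin; near: n; exact: nbhs_infty_ger.
rewrite (_ : (fun _ => _) = fun n => (n%:R `^ r * v)%:E); last first.
  by apply/funext => n; rewrite min_r ?leey.
have -> : (+oo `^ r)%E = +oo%E :> \bar R by rewrite /= gt_eqF.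
rewrite gt0_mulye ?lte_fin//; apply/cvgeyPge => A; near=> n.
rewrite lee_fin -ler_pdivrMr//.
have [A0|A0] := leP (A / v) 0; first by rewrite (le_trans A0)// powR_ge0.
have -> : A / v = ((A / v) `^ r^-1) `^ r.
  by rewrite -powRrM mulVf ?gt_eqF// powRr1// ltW.
apply: ge0_ler_powR; rewrite ?nnegrE ?powR_ge0// ?(ltW r0)//.
by near: n; exact: nbhs_infty_ger.
Unshelve. all: by end_near.
Qed.

Lemma poweR_mul_factor (R : realType) (a b C c s t : R) (X Y : \bar R) :
  (0 <= a%:E)%E -> (0 <= b%:E)%E -> (0 <= X)%E -> (0 <= Y)%E ->
  ((2 * C * c)%:E * ((a%:E * X) `^ s * (b%:E * Y) `^ t) =
   (C * (2 * c * a `^ s * b `^ t))%:E * X `^ s * Y `^ t)%E.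
Proof.
move=> a0 b0 X0 Y0; rewrite !poweRM// !poweR_EFin.
have -> : C * (2 * c * a `^ s * b `^ t) = 2 * C * c * (a `^ s * b `^ t) by ring.
by rewrite muleACA -EFinM [LHS]muleA -EFinM muleA.
Qed.

(** * Stopping times in a finite filtration *)

(** The constant produced by summing the weak maximal inequality over dyadic
levels, [c] being the constant of the geometric series. *)
Definition doob_const (R : realType) (p c : R) : R := 2 `^ p * 2 * c * 2 `^ (p - 1).

Lemma doob_const_ge0 (R : realType) (p c : R) : 0 < c -> (0 <= (doob_const p c)%:E)%E.
Proof. by move=> c0; rewrite lee_fin !mulr_ge0 ?powR_ge0// ltW. Qed.

Section finite_filtration.
Context (d : measure_display) (T : measurableType d) (R : realType).
Variables (mu : {measure set T -> \bar R}) (w : T -> R).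
Hypotheses (mw : measurable_fun [set: T] w) (w0 : forall x, 0 <= w x).
Variable G : nat -> set (set T).
Hypotheses (sG : forall k, sigma_finite_sub mu (G k))
  (G_mono : forall j k, (j <= k)%N -> G j `<=` G k)
  (w_fin : forall k E, finite_part mu (G k) E -> (wmass mu w E < +oo)%E).

Definition adapted (a : nat -> T -> R) :=
  forall k, measurable_wrt (G k) (a k) /\ forall x, 0 <= a k x.

Fixpoint running_max (a : nat -> T -> R) n x : R :=
  if n is m.+1 then Num.max (running_max a m x) (a m x) else 0.

(** Making the superlevel sets disjoint in the order of time is stopping at the
first passage above [t]. *)
Definition first_passage (a : nat -> T -> R) (t : R) : nat -> set T :=
  seqDU (fun k => superlevel (a k) t).

Lemma first_passage_superlevel a t k : first_passage a t k `<=` superlevel (a k) t.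
Proof. by move=> x []. Qed.

Section adapted_lemmas.
Variable a : nat -> T -> R.
Hypothesis ada : adapted a.

Let ma k : measurable_fun [set: T] (a k).
Proof. exact: (measurable_wrt_fun (sG k) (ada k).1). Qed.

Lemma running_max_ge0 n x : 0 <= running_max a n x.
Proof. by elim: n => //= n IHn; rewrite le_max IHn. Qed.

Lemma lt_running_max n t x : 0 <= t ->
  t < running_max a n x <-> exists2 k, (k < n)%N & t < a k x.
Proof.
move=> t0; elim: n => [|n IHn] /=.
  by split=> [|[]//]; rewrite ltNge t0.
rewrite lt_max; split=> [/orP[/IHn[k kn tk]|tn]|[k]].
- by exists k => //; exact: ltnW.
- by exists n.
- rewrite ltnS leq_eqVlt => /predU1P[->->|kn tk]; first by rewrite orbT.
  by apply/orP; left; apply/IHn; exists k.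
Qed.

Lemma le_running_max n k x : (k < n)%N -> a k x <= running_max a n x.
Proof.
elim: n => // n IHn; rewrite ltnS leq_eqVlt /= le_max => /predU1P[->|/IHn->//].
by rewrite lexx orbT.
Qed.

Lemma measurable_running_max n : measurable_fun [set: T] (running_max a n).
Proof. by elim: n => [|n IHn]; [exact: measurable_cst|exact: measurable_maxr]. Qed.

Lemma superlevel_running_max n t : 0 <= t ->
  superlevel (running_max a n) t = \big[setU/set0]_(k < n) first_passage a t k.
Proof.
move=> t0; rewrite -bigsetU_seqDU -(bigcup_mkord n (fun k => superlevel (a k) t)); apply/seteqP; split=> x /=.
  by move=> /(lt_running_max _ _ t0)[k kn tk]; exists k.
by move=> [k /= kn tk]; apply/lt_running_max => //; exists k.
Qed.

Lemma first_passage_sub t k : G k (first_passage a t k).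
Proof.
have mG E : @measurable _ (g_sigma_algebraType (G k)) E = G k E.
  by rewrite (measurable_subE (sG k)).
rewrite /first_passage /seqDU; apply: (sub_setD (sG k)).
  by apply: sub_superlevel; exact: (ada k).1.
rewrite -mG; apply: bigsetU_measurable => j _; rewrite mG.
apply: (G_mono (ltnW (ltn_ord j))); by apply: sub_superlevel; exact: (ada j).1.
Qed.

Lemma measurable_first_passage t k : measurable (first_passage a t k).
Proof. exact/(sub_measurable (sG k))/first_passage_sub. Qed.

Lemma sum_first_passage n t (u : T -> \bar R) : 0 <= t ->
  measurable_fun [set: T] u -> (forall x, (0 <= u x)%E) ->
  (\sum_(k < n) \int[mu]_(x in first_passage a t k) u x =
   \int[mu]_(x in superlevel (running_max a n) t) u x)%E.
Proof.
move=> t0 mu_ u0; rewrite superlevel_running_max//.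
rewrite -(big_mkord xpredT (fun k => \int[mu]_(x in first_passage a t k) u x)%E).
rewrite -(big_mkord xpredT (first_passage a t)).
rewrite ge0_integral_bigsetU//.
- exact: measurable_first_passage.
- exact: iota_uniq.
- by apply: sub_trivIset (trivIset_seqDU _).
- exact: measurable_funTS.
Qed.

End adapted_lemmas.

Section doob.
Variables (f : T -> R) (phi : nat -> T -> R).
Hypotheses (mf : measurable_fun [set: T] f) (f0 : forall x, 0 <= f x).
Hypotheses (aphi : adapted phi)
  (phi_avg : forall k E, finite_part mu (G k) E ->
    (\int[mu]_(x in E) (phi k x * w x)%:E <= \int[mu]_(x in E) (f x * w x)%:E)%E).

(** Stopping when [phi] exceeds [t] gives [t sigma(E) <= int_E f dsigma] for [E]
inside a first-passage set. Since [f] is at most [t / 2] off its own superlevel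
set, half of the left-hand side can be absorbed. Integrating only where [f]
is large makes the sum over [t] converge without any prior knowledge that the
maximal function has a finite norm. *)
Lemma maximal_weak n t : 0 < t ->
  (t%:E * wmass mu w (superlevel (running_max phi n) t) <=
   2%:E * \int[mu]_(x in superlevel f (t / 2)) (f x * w x)%:E)%E.
Proof.
move=> t0.
pose h x := (\1_(superlevel f (t / 2)) x * (f x * w x))%:E.
have mfw : measurable_fun [set: T] (fun x => f x * w x) by exact: measurable_funM.
have ms : measurable (superlevel f (t / 2)) by exact: measurable_level.
have mh : measurable_fun [set: T] h.
  by apply/measurable_EFinP/measurable_funM => //; exact: measurable_indic.
have h0 x : (0 <= h x)%E by rewrite lee_fin !mulr_ge0.
have tw0 x : (0 <= (t * w x)%:E)%E by rewrite lee_fin mulr_ge0// ltW.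
have mtw : measurable_fun [set: T] (fun x => (t * w x)%:E).
  exact/measurable_EFinP/measurable_funM.
have twE E : measurable E -> (\int[mu]_(x in E) (t * w x)%:E = t%:E * wmass mu w E)%E.
  move=> mE; rewrite /wmass -ge0_integralZl_EFin//.
  - by move=> x _; rewrite lee_fin.
  - exact/measurable_funTS/measurable_EFinP.
  - exact: ltW.
have key k E : finite_part mu (G k) E -> E `<=` first_passage phi t k ->
    (\int[mu]_(x in E) (t * w x)%:E <= 2%:E * \int[mu]_(x in E) h x)%E.
  move=> fE Ep; have mE := sub_measurable (sG k) fE.1.
  have wE := w_fin fE.
  have w_num : wmass mu w E \is a fin_num.
    by rewrite ge0_fin_numE// integral_ge0// => x _; rewrite lee_fin.
  have phi0 x : 0 <= phi k x by case: (aphi k).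
  have H1 : (\int[mu]_(x in E) (t * w x)%:E <= \int[mu]_(x in E) (f x * w x)%:E)%E.
    apply: le_trans (phi_avg fE); apply: ge0_le_integral => //.
    - exact: measurable_funTS.
    - apply/measurable_funTS/measurable_EFinP/measurable_funM => //.
      exact: (measurable_wrt_fun (sG k) (aphi k).1).
    - move=> x Ex; have /= tx : superlevel (phi k) t x by apply: first_passage_superlevel; exact: Ep.
      by rewrite lee_fin ler_wpM2r// ltW.
  have H2 : (\int[mu]_(x in E) (f x * w x)%:E <=
      \int[mu]_(x in E) h x + (t / 2)%:E * wmass mu w E)%E.
    rewrite /wmass -ge0_integralZl_EFin//; last 3 first.
    - by move=> x _; rewrite lee_fin.
    - exact/measurable_funTS/measurable_EFinP.
    - by rewrite divr_ge0// ltW.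
    rewrite -ge0_integralD//; last 3 first.
    - exact: measurable_funTS.
    - by move=> x _; rewrite mule_ge0// lee_fin// divr_ge0// ltW.
    - by apply: measurable_funeM; exact/measurable_funTS/measurable_EFinP.
    apply: ge0_le_integral => //.
    - by move=> x _; rewrite lee_fin mulr_ge0.
    - exact/measurable_funTS/measurable_EFinP.
    - apply: emeasurable_funD; first exact: measurable_funTS.
      by apply: measurable_funeM; exact/measurable_funTS/measurable_EFinP.
    - move=> x _; rewrite /h indic_superlevel -EFinM -EFinD lee_fin.
      case: ltP => fx; first by rewrite mul1r lerDl mulr_ge0// divr_ge0// ltW.
      by rewrite mul0r add0r ler_wpM2r.
  rewrite twE// in H1 *.
  have := le_trans H1 H2; rewrite -(fineK w_num) -!EFinM.
  set s := fine _; move: (\int[mu]_(x in E) h x)%E => [r| |] //.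
  - by rewrite -EFinD -EFinM !lee_fin; lra.
  - by move=> _; rewrite gt0_muley ?leey// lte_fin.
have mM := measurable_running_max aphi n.
rewrite -twE; last exact: measurable_level.
rewrite -sum_first_passage//; last exact: ltW.
apply: (@le_trans _ _ (\sum_(k < n) 2%:E * \int[mu]_(x in first_passage phi t k) h x)%E).
  apply: lee_sum => k _.
  have Gk := first_passage_sub aphi t k.
  apply: (integral_le_finite_part (sG k)) => // E fE Ek.
  apply: le_trans (key _ _ fE Ek) _; apply: lee_wpmul2l => //.
  apply: ge0_subset_integral => //.
  - exact: (sub_measurable (sG k) fE.1).
  - exact: measurable_first_passage.
  - exact: measurable_funTS.
rewrite -ge0_sume_distrr; last by move=> k _; exact: integral_ge0.
apply: lee_wpmul2l => //; rewrite sum_first_passage//; last exact: ltW.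
rewrite -(integral_indicM mu (fun x => f x * w x) ms).
by apply: ge0_subset_integral => //; exact: measurable_level.
Qed.

(** The weak inequality at the levels [2^k], summed with weights [2^(k p)]: on the
right the powers [2^(k (p - 1))] below [2 f] add up to a multiple of
[f^(p - 1)]. *)
Lemma doob_maximal n (p c : R) : 1 < p -> dyadic_bound (p - 1) c ->
  (\int[mu]_x (running_max phi n x `^ p * w x)%:E <=
   (doob_const p c)%:E * \int[mu]_x (f x `^ p * w x)%:E)%E.
Proof.
move=> p1 hc; have p0 : 0 < p by exact: lt_trans p1.
have M0 := running_max_ge0 phi n.
have mM := measurable_running_max aphi n.
have mfw : measurable_fun [set: T] (fun x => f x * w x) by exact: measurable_funM.
have m2f : measurable_fun [set: T] (fun x => 2 * f x) by exact: measurable_funM.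
have lf t : superlevel f (t / 2) = superlevel (fun x => 2 * f x) t.
  by apply/seteqP; split=> x; rewrite /superlevel/= ltr_pdivrMr// mulrC.
apply: le_trans (integral_powR_le_layers mu mM mw M0 w0 p0) _.
apply: (@le_trans _ _ ((2 `^ p)%:E * \esum_(k in [set: int])
    (2%:E * ((dyadic R k `^ (p - 1))%:E *
     \int[mu]_(x in superlevel (fun x => 2 * f x)%R (dyadic R k)) (f x * w x)%:E)))%E).
  apply: lee_wpmul2l; first by rewrite lee_fin powR_ge0.
  apply: le_esum => k _; have k0 := dyadic_gt0 R k.
  have := maximal_weak n k0; rewrite lf /wmass => H.
  rewrite -(mulr_powRB1 (ltW k0) p0) mulrC EFinM -muleA [leRHS]muleCA.
  by apply: lee_wpmul2l; rewrite ?lee_fin ?powR_ge0.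
rewrite esumZl//; last first.
  move=> k; rewrite mule_ge0//; first by rewrite lee_fin powR_ge0.
  by apply: integral_ge0 => x _; rewrite lee_fin mulr_ge0.
have -> : (doob_const p c)%:E =
    ((2 `^ p)%:E * (2%:E * (c%:E * (2 `^ (p - 1))%:E)))%E by rewrite /doob_const -!EFinM !mulrA.
rewrite -!muleA; apply: lee_wpmul2l; first by rewrite lee_fin powR_ge0.
apply: lee_wpmul2l => //.
have f20 x : 0 <= 2 * f x by rewrite mulr_ge0.
have fw0 x : 0 <= f x * w x by rewrite mulr_ge0.
apply: le_trans (layers_le_integral_powR mu m2f mfw f20 fw0 hc) _.
apply: lee_wpmul2l; first by rewrite lee_fin ltW//; case: hc.
rewrite -ge0_integralZl_EFin//; last 2 first.
- by move=> x _; rewrite lee_fin mulr_ge0// powR_ge0.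
- apply/measurable_EFinP/measurable_funM => //.
  exact: (measurableT_comp (measurable_powR _) mf).
apply: eq_lee; apply: eq_integral => x _.
rewrite -EFinM powRM// -!mulrA; congr (_ * _)%:E.
by rewrite mulrA [X in X * w x]mulrC mulr_powRB1.
Qed.

End doob.

Section stopping.
Variables (lam a : nat -> T -> R) (n : nat) (C g : R).
Hypotheses (alam : adapted lam) (aa : adapted a) (C0 : 0 <= C) (g0 : 0 <= g).
Hypothesis testing : forall j E, (j < n)%N -> finite_part mu (G j) E ->
  (\int[mu]_(x in E) ((\sum_(i < n | (j <= i)%N) lam i x) * w x)%:E <=
   C%:E * wmass mu w E `^ (1 + g))%E.

Let mlam i : measurable_fun [set: T] (lam i).
Proof. exact: (measurable_wrt_fun (sG i) (alam i).1). Qed.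
Let ma i : measurable_fun [set: T] (a i).
Proof. exact: (measurable_wrt_fun (sG i) (aa i).1). Qed.
Let lam0 i x : 0 <= lam i x. Proof. by case: (alam i). Qed.
Let a0 i x : 0 <= a i x. Proof. by case: (aa i). Qed.
Let mlw i : measurable_fun [set: T] (fun x => (lam i x * w x)%:E).
Proof. exact/measurable_EFinP/measurable_funM. Qed.
Let lw0 i x : (0 <= (lam i x * w x)%:E)%E.
Proof. by rewrite lee_fin mulr_ge0. Qed.
Let mM := measurable_running_max aa n.
Let mass0 E : (0 <= wmass mu w E)%E.
Proof. by apply: integral_ge0 => x _; rewrite lee_fin. Qed.

Lemma wmass_le E E' : measurable E -> measurable E' -> E `<=` E' ->
  (wmass mu w E <= wmass mu w E')%E.
Proof.
move=> mE mE' EE'; apply: ge0_subset_integral => //.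
  exact/measurable_funTS/measurable_EFinP.
by move=> x _; rewrite lee_fin.
Qed.

(** If [a_i] exceeds [t] at a point, that point was stopped at some [j <= i]. *)
Lemma sum_first_passage_tail t : 0 <= t ->
  (\sum_(i < n) \int[mu]_(x in superlevel (a i) t) (lam i x * w x)%:E <=
   \sum_(j < n) \int[mu]_(x in first_passage a t j)
      ((\sum_(i < n | (j <= i)%N) lam i x) * w x)%:E)%E.
Proof.
move=> t0.
apply: (@le_trans _ _ (\sum_(i < n) \sum_(j < n | (j < i.+1)%N)
    \int[mu]_(x in first_passage a t j) (lam i x * w x)%:E)%E).
  apply: lee_sum => i _.
  rewrite -(big_ord_widen n (fun j =>
    \int[mu]_(x in first_passage a t j) (lam i x * w x)%:E)%E (ltn_ord i)).
  rewrite sum_first_passage//; apply: ge0_subset_integral => //.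
  - exact: measurable_level.
  - exact/measurable_level/measurable_running_max.
  - exact: measurable_funTS.
  - by move=> x ax; apply: lt_le_trans ax _; exact: le_running_max.
rewrite (exchange_big_dep xpredT)//=; apply: lee_sum => j _.
apply: eq_lee.
transitivity (\int[mu]_(x in first_passage a t j)
    (\sum_(i < n) (if (j <= i)%N then (lam i x * w x)%:E else 0)))%E.
  rewrite ge0_integral_sum//.
  - rewrite big_mkcond; apply: eq_bigr => i _; rewrite ltnS.
    by case: ifP => // _; rewrite integral0.
  - exact: measurable_first_passage.
  - by move=> i; case: (j <= i)%N; [exact: measurable_funTS|exact: measurable_cst].
  - by move=> i x _; case: (j <= i)%N.
by apply: eq_integral => x _; rewrite -big_mkcond/= sumEFin mulr_suml.
Qed.

(** Testing on the first-passage sets; their masses [X_j] add up to [X], and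
[X_j^(1 + g) <= X_j X^g]. *)
Lemma sum_superlevel_le t : 0 <= t ->
  (\sum_(i < n) \int[mu]_(x in superlevel (a i) t) (lam i x * w x)%:E <=
   C%:E * wmass mu w (superlevel (running_max a n) t) `^ (1 + g))%E.
Proof.
move=> t0; set X := wmass _ _ _; have X0 : (0 <= X)%E by exact: mass0.
have XE : (X = \sum_(j < n) wmass mu w (first_passage a t j))%E.
  rewrite /X /wmass sum_first_passage//.
  exact/measurable_EFinP.
apply: le_trans (sum_first_passage_tail t0) _.
rewrite poweR1D//.
rewrite muleA {1}XE.
rewrite ge0_sume_distrr// ge0_sume_distrl; last by move=> j _; rewrite mule_ge0.
apply: lee_sum => j _.
have Gj := first_passage_sub aa t j.
have mS : measurable_fun [set: T] (fun x => ((\sum_(i < n | (j <= i)%N) lam i x) * w x)%:E).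
  apply/measurable_EFinP/measurable_funM => //.
  under eq_fun do rewrite big_mkcond; apply: measurable_sum => i.
  by case: (j <= i)%N => //; exact: measurable_cst.
apply: (integral_le_finite_part (sG j)) => //.
  by move=> x; rewrite lee_fin mulr_ge0// sumr_ge0.
move=> E fE Ej; apply: le_trans (testing (ltn_ord j) fE) _.
have mE := sub_measurable (sG j) fE.1.
have mj := measurable_first_passage aa t j.
rewrite -muleA; apply: lee_wpmul2l; first by rewrite lee_fin.
rewrite poweR1D//; apply: lee_pmul => //; first exact: poweR_ge0.
  exact: wmass_le.
apply: ge0_le_poweR => //; apply: wmass_le => //.
  exact: measurable_level.
apply: (subset_trans Ej) => x jx.
have := first_passage_superlevel jx; rewrite /superlevel/= => tx.
by apply: lt_le_trans tx _; apply: le_running_max.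
Qed.

(** [sum_superlevel_le] summed over the levels [2^k], made linear in the mass of the
superlevel set by [stopped_layer]. *)
Lemma sum_stopped_le (c : R) : dyadic_bound (1 + g)^-1 c ->
  (\int[mu]_x (running_max a n x `^ (1 + g)^-1 * w x)%:E < +oo)%E ->
  (\sum_(i < n) \int[mu]_x (lam i x * a i x * w x)%:E <=
   (2 * C * c)%:E *
     (\int[mu]_x (running_max a n x `^ (1 + g)^-1 * w x)%:E) `^ (1 + g))%E.
Proof.
move=> hc; set r := (1 + g)^-1 in hc *; set N := (\int[mu]_x _)%E => Noo.
have g1 : 0 < 1 + g by rewrite ltr_wpDr.
have r0 : 0 < r by rewrite invr_gt0.
have M0 := running_max_ge0 a n.
have N0 : (0 <= N)%E.
  by apply: integral_ge0 => x _; rewrite lee_fin mulr_ge0// powR_ge0.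
have N_num : N \is a fin_num by rewrite ge0_fin_numE.
pose L k : \bar R := (dyadic R k)%:E.
have L0 k : (0 <= L k)%E by rewrite lee_fin ltW// dyadic_gt0.
pose I i k : \bar R := (\int[mu]_(x in superlevel (a i) (dyadic R k)) (lam i x * w x)%:E)%E.
have I0 i k : (0 <= I i k)%E by exact: integral_ge0.
pose X k := wmass mu w (superlevel (running_max a n) (dyadic R k)).
have X0 k : (0 <= X k)%E by exact: mass0.
apply: (@le_trans _ _ (\sum_(i < n) (2%:E * \esum_(k in [set: int]) (L k * I i k)))%E).
  apply: lee_sum => i _.
  have lwi0 x : 0 <= lam i x * w x by rewrite mulr_ge0.
  apply: le_trans (integral_le_layers mu (ma i) (measurable_funM (mlam i) mw)
    (a0 i) lwi0).
  apply: eq_lee.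
  by apply: eq_integral => x _; rewrite mulrA [a i x * _]mulrC.
rewrite -ge0_sume_distrr; last first.
  by move=> i _; apply: esum_ge0 => k _; rewrite mule_ge0.
rewrite -esum_sum; last by move=> k i _ _; rewrite mule_ge0.
have step k : (\sum_(i < n) (L k * I i k) <=
    (C * fine N `^ g)%:E * ((dyadic R k `^ r)%:E * X k))%E.
  have k0 := dyadic_gt0 R k.
  rewrite -ge0_sume_distrr//.
  apply: (@le_trans _ _ (L k * (C%:E * X k `^ (1 + g)))%E).
    apply: lee_wpmul2l; first exact: L0.
    by apply: sum_superlevel_le; exact: ltW.
  have H := weighted_chebyshev mu mM mw M0 w0 r0 k0.
  apply: (stopped_layer k0 C0 g0 _ (X0 k)); first exact: fine_ge0.
  by rewrite (fineK N_num).
apply: (@le_trans _ _ (2%:E * ((C * fine N `^ g)%:E * (c%:E * N)))%E).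
  apply: lee_wpmul2l => //.
  apply: (@le_trans _ _ (\esum_(k in [set: int])
      ((C * fine N `^ g)%:E * ((dyadic R k `^ r)%:E * X k)))%E).
    by apply: le_esum => k _.
  rewrite esumZl; last 2 first.
  - by rewrite mulr_ge0// powR_ge0.
  - by move=> k; rewrite mule_ge0// lee_fin powR_ge0.
  apply: lee_wpmul2l; first by rewrite lee_fin mulr_ge0// powR_ge0.
  exact: layers_le_integral_powR.
rewrite poweR1D// -(fineK N_num) poweR_EFin -!EFinM; apply: eq_lee.
by congr (_%:E); ring.
Qed.

End stopping.
(** In the applications [phi] and [psi] are the averages of [f] and [h] with
respect to [w mu]; that their integrals over sets of the filtration do not
exceed those of [f] and [h] is what Doob's inequality uses. *)
Lemma finite_bilinear_bound (lam phi psi : nat -> T -> R) (f h : T -> R) n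
    (p s g C cp cs cr : R) :
  adapted lam -> adapted phi -> adapted psi ->
  measurable_fun [set: T] f -> (forall x, 0 <= f x) ->
  measurable_fun [set: T] h -> (forall x, 0 <= h x) ->
  (forall k E, finite_part mu (G k) E ->
    (\int[mu]_(x in E) (phi k x * w x)%:E <= \int[mu]_(x in E) (f x * w x)%:E)%E) ->
  (forall k E, finite_part mu (G k) E ->
    (\int[mu]_(x in E) (psi k x * w x)%:E <= \int[mu]_(x in E) (h x * w x)%:E)%E) ->
  1 < p -> 1 < s -> 0 <= g -> 0 <= C -> p^-1 + s^-1 = 1 + g ->
  dyadic_bound (p - 1) cp -> dyadic_bound (s - 1) cs -> dyadic_bound (1 + g)^-1 cr ->
  (forall j E, (j < n)%N -> finite_part mu (G j) E ->
    (\int[mu]_(x in E) ((\sum_(i < n | (j <= i)%N) lam i x) * w x)%:E <=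
     C%:E * wmass mu w E `^ (1 + g))%E) ->
  (\int[mu]_x (f x `^ p * w x)%:E < +oo)%E ->
  (\int[mu]_x (h x `^ s * w x)%:E < +oo)%E ->
  (\sum_(i < n) \int[mu]_x (lam i x * (phi i x * psi i x) * w x)%:E <=
   (2 * C * cr)%:E *
     (((doob_const p cp)%:E * \int[mu]_x (f x `^ p * w x)%:E) `^ p^-1 *
      ((doob_const s cs)%:E * \int[mu]_x (h x `^ s * w x)%:E) `^ s^-1))%E.
Proof.
move=> alam aphi apsi mf f0 mh h0 favg havg p1 s1 g0 C0 psg Hcp Hcs Hcr testing Foo Hoo.
set F := (\int[mu]_x (f x `^ p * w x)%:E)%E in Foo *.
set H := (\int[mu]_x (h x `^ s * w x)%:E)%E in Hoo *.
have p0 : 0 < p by exact: lt_trans p1.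
have s0 : 0 < s by exact: lt_trans s1.
have g1 : 0 < 1 + g by rewrite ltr_wpDr.
pose r := (1 + g)^-1; have r0 : 0 < r by rewrite invr_gt0.
have ipow (u : T -> R) (t : R) : (0 <= \int[mu]_x (u x `^ t * w x)%:E)%E.
  by apply: integral_ge0 => x _; rewrite lee_fin mulr_ge0// powR_ge0.
have mpow (u : T -> R) (t : R) : measurable_fun [set: T] u ->
    measurable_fun [set: T] (fun x => u x `^ t).
  by move=> mu_; exact: (measurableT_comp (measurable_powR _) mu_).
pose Mf := running_max phi n; pose Mh := running_max psi n.
pose a k x := phi k x * psi k x.
have phi0 k x : 0 <= phi k x by case: (aphi k).
have psi0 k x : 0 <= psi k x by case: (apsi k).
have aa : adapted a.
  move=> k; split; last by move=> x; rewrite mulr_ge0.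
  by apply: (measurable_wrtM (sG k)); [case: (aphi k)|case: (apsi k)].
have mMf : measurable_fun [set: T] Mf by exact: (measurable_running_max aphi).
have mMh : measurable_fun [set: T] Mh by exact: (measurable_running_max apsi).
have mMa := measurable_running_max aa n.
have Mf0 x : 0 <= Mf x by exact: running_max_ge0.
have Mh0 x : 0 <= Mh x by exact: running_max_ge0.
have Ma0 x : 0 <= running_max a n x by exact: running_max_ge0.
have Ma_le x : running_max a n x <= Mf x * Mh x.
  rewrite leNgt; apply/negP => /(lt_running_max a n x (mulr_ge0 (Mf0 x) (Mh0 x))).
  move=> [k kn]; apply/negP; rewrite -leNgt.
  by apply: ler_pM => //; exact: le_running_max.
have DF : (\int[mu]_x (Mf x `^ p * w x)%:E <= (doob_const p cp)%:E * F)%E.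
  exact: (doob_maximal mf f0 aphi favg n p1 Hcp).
have DH : (\int[mu]_x (Mh x `^ s * w x)%:E <= (doob_const s cs)%:E * H)%E.
  exact: (doob_maximal mh h0 apsi havg n s1 Hcs).
set N := (\int[mu]_x (running_max a n x `^ r * w x)%:E)%E.
have N0 : (0 <= N)%E by exact: ipow.
have HN : (N <= (\int[mu]_x (Mf x `^ p * w x)%:E) `^ (r / p) *
    (\int[mu]_x (Mh x `^ s * w x)%:E) `^ (r / s))%E.
  apply: (@le_trans _ _ (\int[mu]_x (Mf x `^ r * Mh x `^ r * w x)%:E)%E).
    apply: ge0_le_integral => //.
    - by move=> x _; rewrite lee_fin mulr_ge0// powR_ge0.
    - by apply/measurable_EFinP/measurable_funM => //; exact: mpow.
    - by apply/measurable_EFinP; do 2 (apply: measurable_funM => //); exact: mpow.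
    - move=> x _; rewrite lee_fin -powRM// ler_wpM2r//.
      by apply: ge0_ler_powR; rewrite ?nnegrE ?mulr_ge0// ltW.
  have pr : 0 < p / r by rewrite divr_gt0.
  have sr : 0 < s / r by rewrite divr_gt0.
  have prs : (p / r)^-1 + (s / r)^-1 = 1.
    by rewrite !invf_div -mulrDr psg /r mulVf ?gt_eqF.
  have := weighted_hoelder mu (mpow _ r mMf) (mpow _ r mMh) mw
    (fun x => powR_ge0 _ _) (fun x => powR_ge0 _ _) w0 pr sr prs.
  rewrite !invf_div.
  have powE (u : T -> R) (t : R) :
      (\int[mu]_x ((u x `^ r) `^ (t / r) * w x)%:E = \int[mu]_x (u x `^ t * w x)%:E)%E.
    apply: eq_integral => x _; rewrite -powRrM; congr (_ `^ _ * _)%:E.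
    by rewrite mulrCA divff ?mulr1// gt_eqF.
  move=> HH; apply: (le_trans HH).
  rewrite [X in (X `^ _ * _ <= _)%E](powE Mf p).
  rewrite [X in (_ * X `^ _ <= _)%E](powE Mh s).
  exact: lexx.
have AF := lte_mul_pinfty (doob_const_ge0 p Hcp.1) (isT : (doob_const p cp)%:E \is a fin_num) Foo.
have AH := lte_mul_pinfty (doob_const_ge0 s Hcs.1) (isT : (doob_const s cs)%:E \is a fin_num) Hoo.
have [Noo NB] := poweR_mul_bound g0 p0 s0 N0 (ipow Mf p) (ipow Mh s) HN DF DH AF AH.
have stop := sum_stopped_le alam aa C0 g0 testing Hcr Noo.
apply: (le_trans stop); apply: lee_wpmul2l; last exact: NB.
by rewrite lee_fin !mulr_ge0// ltW//; case: Hcr.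
Qed.

End finite_filtration.

(** * The operator in terms of the weighted measure *)

Section weighted_operator.
Context (d : measure_display) (T : measurableType d) (R : realType).
Variables (mu : {measure set T -> \bar R}) (F : int -> set (set T))
  (alpha : int -> T -> R) (w : T -> R).
Hypotheses (filF : sigma_finite_filtration mu F) (admF : admissible F alpha)
  (wF : weight mu F w).
Implicit Types (f g : T -> R) (i j : int) (p r s C : R).

Lemma filtration_sigma_finite_sub i : sigma_finite_sub mu (F i).
Proof.
by split; [exact: (filtration_sigma_algebra filF)|exact: (filtration_sub filF)|
  exact: (filtration_sub_sigma_finite filF)].
Qed.
Local Notation sF := filtration_sigma_finite_sub.

Lemma filtration_le i j : i <= j -> F i `<=` F j.
Proof. by rewrite le_eqVlt => /predU1P[->//|]; exact: (filtration_mono filF). Qed.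

Let w0 x : 0 <= w x. Proof. by case: wF => _. Qed.
Let mw : measurable_fun [set: T] w. Proof. by case: wF => -[]. Qed.
Let alpha0 i x : 0 <= alpha i x. Proof. by case: (admF i). Qed.
Let malpha i : measurable_wrt (F i) (alpha i). Proof. by case: (admF i). Qed.

Lemma wmass_lty i E : finite_part mu (F i) E -> (wmass mu w E < +oo)%E.
Proof.
move=> fE; have [[_ /(_ i E fE)/integrableP[_]]] := wF.
by under eq_integral do rewrite /= ger0_norm//.
Qed.

Lemma weight_nonneg_integrable i : nonneg_integrable mu (F i) w.
Proof. by split=> //; case: wF => -[_ + _]; exact. Qed.

Local Notation cexp i := (pcond_exp mu (F i)).

Lemma wnormE f p : (forall x, 0 <= f x) ->
  wnorm mu w p f = ((\int[mu]_x (f x `^ p * w x)%:E) `^ p^-1)%E.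
Proof.
move=> f0; rewrite /wnorm (eq_integral (fun x => (f x `^ p * w x)%:E)) => [|x _].
  exact: erefl.
by rewrite ger0_norm.
Qed.

Lemma in_Lpw_lty f p : 0 < p -> (forall x, 0 <= f x) -> in_Lpw mu w p f ->
  (\int[mu]_x (f x `^ p * w x)%:E < +oo)%E.
Proof.
move=> p0 f0 [_]; rewrite wnormE//.
case: (\int[mu]_x _)%E => //= [r _|]; first by rewrite ltry.
by rewrite gt_eqF// invr_gt0.
Qed.

Lemma integral_indic_powR E p : measurable E -> 0 < p ->
  (\int[mu]_x (\1_E x `^ p * w x)%:E = wmass mu w E)%E.
Proof.
move=> mE p0; rewrite /wmass -(integral_indicM mu w mE); apply: eq_integral => x _.
by rewrite indicE; case: (_ \in _); rewrite ?powR1// powR0// gt_eqF.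
Qed.

Lemma wnorm_indic E p : measurable E -> 0 < p ->
  (wnorm mu w p \1_E = wmass mu w E `^ p^-1)%E.
Proof.
move=> mE p0; rewrite wnormE; last by move=> x; rewrite indicE.
by rewrite [X in (X `^ _)%E](integral_indic_powR mE p0).
Qed.

Lemma integral_hoelder_part E f p r : measurable E -> measurable_fun [set: T] f ->
  (forall x, 0 <= f x) -> 0 < p -> 0 < r -> p^-1 + r^-1 = 1 ->
  (\int[mu]_(x in E) (f x * w x)%:E <=
   (\int[mu]_x (f x `^ p * w x)%:E) `^ p^-1 * wmass mu w E `^ r^-1)%E.
Proof.
move=> mE mf f0 p0 r0 pr.
have m1 : measurable_fun [set: T] (\1_E : T -> R) by exact: measurable_indic.
have i0 x : 0 <= \1_E x :> R by rewrite indicE.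
have := weighted_hoelder mu mf m1 mw f0 i0 w0 p0 r0 pr.
rewrite [X in (_ <= _ * X `^ _)%E -> _](integral_indic_powR mE r0).
apply: le_trans.
rewrite -(integral_indicM mu (fun x => f x * w x) mE); apply: eq_lee.
by apply: eq_integral => x _; rewrite mulrCA mulrA.
Qed.

(** Conditional expectations of [f w] exist because Hoelder's inequality bounds the
integral of [f w] over [E] by the norm of [f] and a power of the mass of [E]. *)
Lemma Lpw_nonneg_integrable i f p : 1 < p -> (forall x, 0 <= f x) ->
  in_Lpw mu w p f -> nonneg_integrable mu (F i) (f \* w).
Proof.
move=> p1 f0 Lf; have [mf _] := Lf; have p0 : 0 < p by exact: lt_trans p1.
have mfw : measurable_fun [set: T] (f \* w) by exact: measurable_funM.
split=> // [x|E fE]; first by rewrite mulr_ge0.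
have mE := sub_measurable (sF i) fE.1.
apply/integrableP; split; first exact/measurable_funTS/measurable_EFinP.
under eq_integral do rewrite /= ger0_norm ?mulr_ge0//.
have r0 : 0 < (1 - p^-1)^-1 by rewrite invr_gt0 subr_gt0 invf_lt1.
have pr : p^-1 + (1 - p^-1)^-1^-1 = 1 by rewrite invrK addrC subrK.
apply: (le_lt_trans (integral_hoelder_part mE mf f0 p0 r0 pr)).
have pow_lty (x : \bar R) t : (x < +oo)%E -> (x `^ t < +oo)%E.
  by case: x => [x _|//|_] /=; [rewrite ltry|case: ifP => _; rewrite ltry].
apply: lte_mul_pinfty; first exact: poweR_ge0.
  rewrite ge0_fin_numE; last exact: poweR_ge0.
  by apply: pow_lty; exact: in_Lpw_lty.
by apply: pow_lty; exact: (wmass_lty fE).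
Qed.

Lemma tail_sumE i x :
  tail_sum mu F alpha w i x = \esum_(j in [set j : int | i <= j]) (cexp j w x * alpha j x)%:E.
Proof.
rewrite /tail_sum -esum_pos_part; apply: eq_esum => j _.
rewrite -EFin_max; congr (_%:E); rewrite /pcond_exp.
by rewrite maxr_pMl// mul0r.
Qed.

Lemma T_op_norm_esum f g : (forall i, nonneg_integrable mu (F i) f) ->
  (forall i, nonneg_integrable mu (F i) g) ->
  ('N[mu]_1[T_op mu F alpha f g] =
   \esum_(i in [set: int]) \int[mu]_x (alpha i x * cexp i f x * cexp i g x)%:E)%E.
Proof.
move=> nf ng; rewrite Lnorm1.
have mc i h : nonneg_integrable mu (F i) h ->
    measurable_fun [set: T] (cond_exp mu (F i) h).
  by move=> /(cond_expP (sF i))[mh _ _]; exact: (measurable_wrt_fun (sF i)).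
have mce i h : nonneg_integrable mu (F i) h -> measurable_fun [set: T] (cexp i h).
  by move=> /(measurable_wrt_pcond_exp (sF i)) mh; exact: (measurable_wrt_fun (sF i)).
have mal i : measurable_fun [set: T] (alpha i) by exact: (measurable_wrt_fun (sF i)).
pose t i x := (alpha i x * cond_exp mu (F i) f x * cond_exp mu (F i) g x)%:E.
have mt i : measurable_fun [set: T] (fun x => maxe 0 (t i x))%E.
  apply: measurable_maxe => //; apply/measurable_EFinP.
  by do 2 (apply: measurable_funM; last exact: mc).
transitivity (\int[mu]_x (\esum_(i in [set: int]) maxe 0 (t i x)))%E.
  apply: eq_integral => x _; rewrite esum_pos_part gee0_abs//.
  rewrite /T_op -esum_pos_part; apply: esum_ge0 => i _.
  by rewrite le_max lexx.
rewrite integral_esum//; last by move=> i x; rewrite le_max lexx.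
apply: eq_esum => i _; apply: ae_eq_integral => //.
  apply/measurable_EFinP; do 2 (apply: measurable_funM; last exact: mce).
  exact: mal.
have := ae_pcond_exp (sF i) (ng i); have := ae_pcond_exp (sF i) (nf i).
apply: filterS2 => x fx gx _; rewrite /t fx gx.
by apply/max_idPr; rewrite lee_fin !mulr_ge0// pcond_exp_ge0.
Qed.

(** * Necessity of the testing conditions *)

Lemma measurable_wrt_cexp i j f : i <= j -> nonneg_integrable mu (F i) f ->
  measurable_wrt (F j) (cexp i f).
Proof.
by move=> ij nf B mB; apply: (filtration_le ij); exact: (measurable_wrt_pcond_exp (sF i) nf).
Qed.

Lemma nonneg_integrable_indic i E : finite_part mu (F i) E ->
  forall j, nonneg_integrable mu (F j) (\1_E \* w).
Proof.
move=> fE j; have mE := sub_measurable (sF i) fE.1.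
have m1 : measurable_fun [set: T] (\1_E : T -> R) by exact: measurable_indic.
have mEw : measurable_fun [set: T] (\1_E \* w) by exact: measurable_funM.
have [_ _ intw] := weight_nonneg_integrable j.
split=> // [x|E' fE']; first by rewrite mulr_ge0// indicE.
have mE' := sub_measurable (sF j) fE'.1.
apply: (le_integrable mE' _ _ (intw _ fE')); first exact/measurable_funTS/measurable_EFinP.
move=> x _ /=; rewrite lee_fin normrM ler_piMl//.
by rewrite indicE; case: (_ \in _); rewrite ?normr1 ?normr0.
Qed.

(** The indicator leaves the conditional expectation by pulling out three times:
of [1_E w], of [w] and of [g w]. *)
Lemma integral_cexp_indic i j E g : i <= j -> finite_part mu (F i) E ->
  nonneg_integrable mu (F j) (g \* w) ->
  (\int[mu]_x (alpha j x * cexp j (\1_E \* w) x * cexp j (g \* w) x)%:E =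
   \int[mu]_x ((\1_E x * g x * w x) * (cexp j w x * alpha j x))%:E)%E.
Proof.
move=> ij fE ng.
have nw := weight_nonneg_integrable j.
have n1 := nonneg_integrable_indic fE j.
have m1 : measurable_wrt (F j) (\1_E : T -> R).
  by apply: (measurable_wrt_indic (sF j)); apply: (filtration_le ij); case: fE.
have i0 x : 0 <= \1_E x :> R by rewrite indicE.
have mg := measurable_wrt_cexp (lexx j) ng.
have mcw := measurable_wrt_cexp (lexx j) nw.
have c0 f x : 0 <= cexp j f x by exact: pcond_exp_ge0.
have M := measurable_wrtM (sF j).
transitivity (\int[mu]_x ((alpha j x * cexp j (g \* w) x) * cexp j (\1_E \* w) x)%:E)%E.
  by apply: eq_integral => x _; rewrite mulrAC.
rewrite (integral_pcond_exp (sF j) n1); last 2 first.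
- by move=> x; rewrite mulr_ge0.
- exact: M.
transitivity (\int[mu]_x ((alpha j x * cexp j (g \* w) x * \1_E x) * w x)%:E)%E.
  by apply: eq_integral => x _ /=; rewrite mulrA.
rewrite -(integral_pcond_exp (sF j) nw); last 2 first.
- by move=> x; rewrite !mulr_ge0.
- by apply: (M) => //; exact: M.
transitivity (\int[mu]_x ((alpha j x * \1_E x * cexp j w x) * cexp j (g \* w) x)%:E)%E.
  by apply: eq_integral => x _; congr (_%:E); ring.
rewrite (integral_pcond_exp (sF j) ng); last 2 first.
- by move=> x; rewrite !mulr_ge0.
- by apply: (M) => //; exact: M.
by apply: eq_integral => x _; congr (_%:E) => /=; ring.
Qed.

Lemma measurable_tail_sum i : measurable_fun [set: T] (tail_sum mu F alpha w i).
Proof.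
rewrite (_ : tail_sum _ _ _ _ _ = fun x =>
    \esum_(j in [set j : int | (i <= j)%R]) (cexp j w x * alpha j x)%:E); last first.
  by apply/funext => x; exact: tail_sumE.
apply: emeasurable_esum => j; last first.
  by move=> x; rewrite lee_fin mulr_ge0// pcond_exp_ge0.
apply/measurable_EFinP/(measurable_wrt_fun (sF j))/(measurable_wrtM (sF j)) => //.
exact/measurable_wrt_cexp/weight_nonneg_integrable.
Qed.

Lemma tail_sum_ge0 i x : (0 <= tail_sum mu F alpha w i x)%E.
Proof.
rewrite tail_sumE; apply: esum_ge0 => j _.
by rewrite lee_fin mulr_ge0// pcond_exp_ge0.
Qed.

Lemma in_Lpw_indic i E p : 0 < p -> finite_part mu (F i) E -> in_Lpw mu w p \1_E.
Proof.
move=> p0 fE; have mE := sub_measurable (sF i) fE.1.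
split; first exact: measurable_indic.
rewrite wnorm_indic//; have := wmass_lty fE.
by case: (wmass _ _ _) => [x _|//|_] /=; [rewrite ltry|case: ifP => _; rewrite ltry].
Qed.

(** The form tested on [1_E], with only the terms [j >= i] kept: there [1_E] is
measurable for the j-th sigma-algebra. *)
Lemma bilinear_bound_tail s r C i E g : 1 < s -> 1 < r -> 0 <= C ->
  bilinear_bound mu F alpha w s r C -> finite_part mu (F i) E ->
  (forall x, 0 <= g x) -> in_Lpw mu w r g ->
  (\int[mu]_x (tail_sum mu F alpha w i x * (\1_E x * g x * w x)%:E) <=
   C%:E * wmass mu w E `^ s^-1 * wnorm mu w r g)%E.
Proof.
move=> s1 r1 C0 bb fE g0 Lg; have s0 : 0 < s by exact: lt_trans s1.
have mE := sub_measurable (sF i) fE.1.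
have i0 x : 0 <= \1_E x :> R by rewrite indicE.
have mg : measurable_fun [set: T] g by case: Lg.
have ng j : nonneg_integrable mu (F j) (g \* w) by exact: Lpw_nonneg_integrable r1 g0 Lg.
have := bb \1_E g i0 g0 (in_Lpw_indic s0 fE) Lg.
rewrite (wnorm_indic mE s0) (T_op_norm_esum (nonneg_integrable_indic fE) ng).
apply: le_trans.
apply: le_trans (le_esum_subset _ (@subsetT _ [set j : int | (i <= j)%R])).
have k0 x : 0 <= \1_E x * g x * w x by rewrite !mulr_ge0.
apply: eq_lee.
have mcw j : measurable_wrt (F j) (cexp j w).
  exact: measurable_wrt_cexp (weight_nonneg_integrable j).
pose t j x := ((\1_E x * g x * w x) * (cexp j w x * alpha j x))%:E.
have t0 j x : (0 <= t j x)%E by rewrite lee_fin !mulr_ge0// pcond_exp_ge0.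
have mt j : measurable_fun [set: T] (t j).
  apply/measurable_EFinP/measurable_funM.
    by do 2 (apply: measurable_funM => //).
  exact/(measurable_wrt_fun (sF j))/(measurable_wrtM (sF j)).
transitivity (\int[mu]_x (\esum_(j in [set j : int | (i <= j)%R]) t j x))%E.
  apply: eq_integral => x _; rewrite tail_sumE muleC -esumZl//.
  by move=> j; rewrite lee_fin mulr_ge0// pcond_exp_ge0.
rewrite integral_esum//; apply: eq_esum => j /= ij.
by rewrite (integral_cexp_indic ij fE).
Qed.

(** [bilinear_bound_tail] with a power of the truncated tail sum in the place of
[g]: the right-hand side then contains the integral to be bounded. *)
Lemma testing_necessary s r r' C : 1 < s -> 1 < r -> r^-1 + r'^-1 = 1 -> 0 <= C ->
  bilinear_bound mu F alpha w s r' C -> testing_bound mu F alpha w r s C.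
Proof.
move=> s1 r1 rr' C0 bb i E fE; set S := tail_sum mu F alpha w i.
have s0 : 0 < s by exact: lt_trans s1.
have r0 : 0 < r by exact: lt_trans r1.
have rV1 : r^-1 < 1 by rewrite invf_lt1.
have r'V : r'^-1 = 1 - r^-1 by rewrite -rr' addrC addKr.
have r'1 : 1 < r'.
  by rewrite -[r']invrK r'V invf_gt1 ?subr_gt0// gtrBl invr_gt0.
have r'0 : 0 < r' by exact: lt_trans r'1.
have rE : (r - 1) * r' = r.
  rewrite -[r']invrK r'V -[X in _ * (X - _)^-1](@divff _ r) ?gt_eqF//.
  by rewrite -[X in _ - X]mul1r -mulrBl invf_div mulrA mulrAC divff ?mul1r// gt_eqF ?subr_gt0.
have mE := sub_measurable (sF i) fE.1.
have mS : measurable_fun [set: T] S by exact: measurable_tail_sum.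
have S0 x : (0 <= S x)%E by exact: tail_sum_ge0.
have i0 x : 0 <= \1_E x :> R by rewrite indicE.
have m1 : measurable_fun [set: T] (\1_E : T -> R) by exact: measurable_indic.
pose Sn (n : nat) x : R := fine (mine (S x) n%:R%:E).
have SnE n x : (Sn n x)%:E = mine (S x) n%:R%:E.
  rewrite fineK// ge0_fin_numE; first by rewrite gt_min ltry orbT.
  by rewrite le_min S0 lee_fin ler0n.
have Sn0 n x : 0 <= Sn n x by rewrite -lee_fin SnE le_min S0 lee_fin ler0n.
have SnS n x : ((Sn n x)%:E <= S x)%E by rewrite SnE ge_min lexx.
have Snn n x : Sn n x <= n%:R by rewrite -lee_fin SnE ge_min lexx orbT.
have mSn n : measurable_fun [set: T] (Sn n).
  apply/measurable_EFinP; rewrite (_ : EFin \o _ = fun x => mine (S x) n%:R%:E).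
    exact: measurable_mine.
  by apply/funext => x /=; rewrite SnE.
have mpow (u : T -> R) t : measurable_fun [set: T] u ->
    measurable_fun [set: T] (fun x => u x `^ t).
  by move=> mu_; exact: (measurableT_comp (measurable_powR _) mu_).
pose D := (C%:E * wmass mu w E `^ s^-1)%E.
have mass0 : (0 <= wmass mu w E)%E.
  by apply: integral_ge0 => x _; rewrite lee_fin.
have massoo := wmass_lty fE.
have D0 : (0 <= D)%E by rewrite mule_ge0 ?poweR_ge0// lee_fin.
pose I n := (\int[mu]_x (\1_E x * Sn n x `^ r * w x)%:E)%E.
have I0 n : (0 <= I n)%E.
  by apply: integral_ge0 => x _; rewrite lee_fin !mulr_ge0// powR_ge0.
(* Truncating makes [I n] finite, which the absorption in [le_poweR_self] needs. *)
have Ioo n : (I n < +oo)%E.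
  apply: (@le_lt_trans _ _ ((n%:R `^ r)%:E * wmass mu w E)%E); last first.
    by apply: lte_mul_pinfty => //; rewrite lee_fin powR_ge0.
  rewrite /wmass -(integral_indicM mu w mE) -ge0_integralZl_EFin; last 4 first.
  - exact: measurableT.
  - by move=> x _; rewrite lee_fin mulr_ge0.
  - exact/measurable_EFinP/measurable_funM.
  - exact: powR_ge0.
  apply: ge0_le_integral => //.
  - by move=> x _; rewrite lee_fin !mulr_ge0// powR_ge0.
  - apply/measurable_EFinP/measurable_funM => //.
    by apply: measurable_funM => //; exact: mpow.
  - by apply: measurable_funeM; exact/measurable_EFinP/measurable_funM.
  - move=> x _; rewrite -EFinM lee_fin mulrA; apply: ler_wpM2r => //.
    rewrite mulrC; apply: ler_wpM2r => //.
    by apply: ge0_ler_powR; rewrite ?nnegrE ?ler0n// ltW.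
(* [r - 1] is the exponent for which [g^r'] is the integrand of [I n]. *)
have ID n : (I n <= D * I n `^ r'^-1)%E.
  pose g x := \1_E x * Sn n x `^ (r - 1).
  have g0 x : 0 <= g x by rewrite mulr_ge0// powR_ge0.
  have mg : measurable_fun [set: T] g by apply: measurable_funM => //; exact: mpow.
  have gE : (wnorm mu w r' g = I n `^ r'^-1)%E.
    rewrite wnormE// /I (eq_integral (fun x => (\1_E x * Sn n x `^ r * w x)%:E)) => [|x _].
      exact: erefl.
    rewrite /g indicE; case: (_ \in _); rewrite /= ?mul1r ?mul0r ?powR0 ?gt_eqF ?mul0r//.
    by rewrite -powRrM rE.
  have Lg : in_Lpw mu w r' g.
    split => //; rewrite gE; have := Ioo n.
    by case: (I n) => [x _|//|_] /=; [rewrite ltry|case: ifP => _; rewrite ltry].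
  have := bilinear_bound_tail s1 r'1 C0 bb fE g0 Lg.
  rewrite gE; apply: le_trans; apply: ge0_le_integral => //.
  - by move=> x _; rewrite lee_fin !mulr_ge0// powR_ge0.
  - apply/measurable_EFinP/measurable_funM => //.
    by apply: measurable_funM => //; exact: mpow.
  - apply: emeasurable_funM => //; apply/measurable_EFinP/measurable_funM => //.
    exact: measurable_funM.
  - move=> x _.
    have -> : \1_E x * Sn n x `^ r * w x = Sn n x * (\1_E x * g x * w x).
      rewrite -(mulr_powRB1 (Sn0 n x) r0) /g indicE.
      by case: (_ \in _); rewrite ?mul0r ?mulr0// !mul1r mulrA.
    rewrite EFinM; apply: lee_wpmul2r; last exact: SnS.
    by rewrite lee_fin; apply: mulr_ge0 => //; exact: mulr_ge0.
have I_le n : (I n <= D `^ r)%E.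
  exact: le_poweR_self r0 rr' (I0 n) (Ioo n) D0 (ID n).
suff H : (\int[mu]_(x in E) (S x `^ r * (w x)%:E) <= D `^ r)%E.
  have int0 : (0 <= \int[mu]_(x in E) (S x `^ r * (w x)%:E))%E.
    by apply: integral_ge0 => x _; rewrite mule_ge0 ?poweR_ge0// lee_fin.
  apply: (@le_trans _ _ ((D `^ r) `^ r^-1)%E).
    by apply: ge0_le_poweR => //; rewrite invr_ge0 ltW.
  by rewrite -poweRrM divff ?gt_eqF// poweRe1.
rewrite integral_mkcond.
apply: (@integral_le_lim _ _ _ mu (fun n x => (\1_E x * Sn n x `^ r * w x)%:E)) => //.
- move=> n; apply/measurable_EFinP/measurable_funM => //.
  by apply: measurable_funM => //; exact: mpow.
- by move=> n x; rewrite lee_fin !mulr_ge0// powR_ge0.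
- move=> x m n mn; have Smn : Sn m x <= Sn n x.
    by rewrite -lee_fin !SnE le_min ge_min lexx/= ge_min orbC lee_fin ler_nat mn.
  rewrite lee_fin; apply: ler_wpM2r; first exact: w0.
  apply: ler_wpM2l; first exact: i0.
  by apply: ge0_ler_powR; rewrite ?nnegrE ?(ltW r0).
- move=> x; rewrite patchE; case: ifPn => xE.
    under eq_cvg do rewrite indicE xE mul1r.
    exact: cvg_truncation.
  rewrite (_ : (fun _ => _) = cst 0%E); first exact: cvg_cst.
  by apply/funext => n; rewrite indicE (negbTE xE) !mul0r.
Qed.

(** * Sufficiency of the testing conditions *)

(** The conditional expectation of [f] with respect to the measure [w mu]; its
value is 0 where that of [w] vanishes. *)
Definition wavg i f x := cexp i (f \* w) x / cexp i w x.

Let c0 i f x : 0 <= cexp i f x. Proof. exact: pcond_exp_ge0. Qed.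

Lemma wavg_ge0 i f x : 0 <= wavg i f x.
Proof. by rewrite divr_ge0. Qed.

Let nw i : nonneg_integrable mu (F i) w.
Proof. exact: weight_nonneg_integrable. Qed.

Let mcw i : measurable_wrt (F i) (cexp i w).
Proof. exact: (measurable_wrt_cexp (lexx i)). Qed.

Lemma measurable_wrt_wavg i f : nonneg_integrable mu (F i) (f \* w) ->
  measurable_wrt (F i) (wavg i f).
Proof.
move=> nf; apply: (measurable_wrtM (sF i)).
  exact: (measurable_wrt_cexp (lexx i)).
by apply: (measurable_wrtV (sF i)).
Qed.

Lemma integral_wavg_le i f E : nonneg_integrable mu (F i) (f \* w) ->
  finite_part mu (F i) E ->
  (\int[mu]_(x in E) (wavg i f x * w x)%:E <= \int[mu]_(x in E) (f x * w x)%:E)%E.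
Proof.
move=> nf fE; have mE := sub_measurable (sF i) fE.1.
have i0 x : 0 <= \1_E x :> R by rewrite indicE.
have m1 : measurable_wrt (F i) (\1_E : T -> R).
  by apply: (measurable_wrt_indic (sF i)); case: fE.
rewrite -(integral_indicM mu (fun x => wavg i f x * w x) mE).
rewrite -(integral_indicM mu (fun x => f x * w x) mE).
rewrite -(integral_pcond_exp (sF i) nf i0 m1).
under eq_integral do rewrite mulrA.
rewrite -(integral_pcond_exp (sF i) (nw i)); last 2 first.
- by move=> x; rewrite mulr_ge0// wavg_ge0.
- by apply: (measurable_wrtM (sF i)) => //; exact: measurable_wrt_wavg.
have mT f' : measurable_wrt (F i) f' -> measurable_fun [set: T] f'.
  exact: (measurable_wrt_fun (sF i)).
apply: ge0_le_integral => //.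
- by move=> x _; rewrite lee_fin mulr_ge0// mulr_ge0// wavg_ge0.
- apply/measurable_EFinP/measurable_funM; last exact: mT.
  by apply: measurable_funM; apply: mT => //; exact: measurable_wrt_wavg.
- apply/measurable_EFinP/measurable_funM; first exact: mT.
  by apply/mT/(measurable_wrt_cexp (lexx i)).
- move=> x _; rewrite lee_fin -mulrA; apply: ler_wpM2l => //.
  rewrite /wavg.
  have [->|cn0] := eqVneq (cexp i w x) 0; first by rewrite mulr0.
  by rewrite divfK.
Qed.

(** The set where the conditional expectation of [w] vanishes belongs to the
sigma-algebra, so [w] and its conditional expectation have the same integral,
zero, over it. *)
Lemma ae_cexp_weight i : {ae mu, forall x, cexp i w x = 0 -> w x = 0}.
Proof.
pose Z := [set x | cexp i w x = 0].
have FZ : F i Z := sub_eq 0 (mcw i).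
have mZ := sub_measurable (sF i) FZ.
have mwZ : measurable_fun Z (EFin \o w) by exact/measurable_funTS/measurable_EFinP.
have /(ae_eq_integral_abs mu mZ mwZ) : (\int[mu]_(x in Z) `|(EFin \o w) x| = 0)%E.
  under eq_integral do rewrite /= ger0_norm//.
  rewrite -(integral_indicM mu w mZ).
  rewrite -(integral_pcond_exp (sF i) (nw i)); last 2 first.
  - by move=> x; rewrite indicE.
  - exact: (measurable_wrt_indic (sF i)).
  rewrite (eq_integral (cst 0%E)) => [|x _]; first by rewrite integral0.
  rewrite indicE; case: (boolP (x \in Z)) => [/[!inE] Zx|_]; last by rewrite mul0r.
  by rewrite Zx mulr0.
by apply: filterS => x /[apply] /= -[].
Qed.

(** Writing the conditional expectation of [f w] as that of [w] times the average
of [f] is possible only where the former does not vanish; elsewhere [w]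
vanishes almost everywhere, and the indicator [\1_P] can be inserted. *)
Lemma integral_cexpM i f g : nonneg_integrable mu (F i) (f \* w) ->
  nonneg_integrable mu (F i) (g \* w) ->
  (\int[mu]_x (alpha i x * cexp i (f \* w) x * cexp i (g \* w) x)%:E =
   \int[mu]_x ((cexp i w x * alpha i x) * (wavg i f x * wavg i g x) * w x)%:E)%E.
Proof.
move=> nf ng.
have mf := measurable_wrt_cexp (lexx i) nf.
have mg := measurable_wrt_cexp (lexx i) ng.
have M := measurable_wrtM (sF i).
have mT f' : measurable_wrt (F i) f' -> measurable_fun [set: T] f'.
  exact: (measurable_wrt_fun (sF i)).
pose P := superlevel (cexp i w) 0.
have FP : F i P by exact: (sub_superlevel 0 (mcw i)).
have mP := sub_measurable (sF i) FP.
have m1 : measurable_wrt (F i) (\1_P : T -> R) by exact: (measurable_wrt_indic (sF i)).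
have i0 x : 0 <= \1_P x :> R by rewrite indicE.
have [mgw gw0 _] := ng.
rewrite (integral_pcond_exp (sF i) ng); last 2 first.
- by move=> x; rewrite mulr_ge0.
- exact: M.
transitivity (\int[mu]_x ((\1_P x * (alpha i x * cexp i (f \* w) x)) * (g \* w) x)%:E)%E.
  apply: ae_eq_integral => //.
  - by apply/measurable_EFinP/measurable_funM => //; apply/mT/M.
  - apply/measurable_EFinP/measurable_funM => //; apply/mT; apply: (M) => //.
    exact: M.
  - apply: filterS (ae_cexp_weight i) => x wx _; rewrite indic_superlevel.
    have := c0 i w x; rewrite le_eqVlt => /predU1P[cx|->]; last by rewrite mul1r.
    by rewrite /= wx// !mulr0.
rewrite -(integral_pcond_exp (sF i) ng); last 2 first.
- by move=> x; rewrite !mulr_ge0.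
- by apply: (M) => //; exact: M.
have mW h : nonneg_integrable mu (F i) (h \* w) -> measurable_wrt (F i) (wavg i h).
  exact: measurable_wrt_wavg.
rewrite -(integral_pcond_exp (sF i) (nw i)); last 2 first.
- by move=> x; apply: mulr_ge0; apply: mulr_ge0 => //; exact: wavg_ge0.
- by apply: (M); [exact: M|apply: M; exact: mW].
apply: eq_integral => x _; rewrite indic_superlevel /wavg.
have := c0 i w x; rewrite le_eqVlt => /predU1P[<-|cx]; first by rewrite ltxx !mul0r.
by rewrite cx mul1r; congr (_%:E); field; rewrite gt_eqF.
Qed.

Lemma sum_le_tail_sum (n j : nat) (m : int) x :
  ((\sum_(k < n | (j <= k)%N) cexp (m + k%:Z)%R w x * alpha (m + k%:Z)%R x)%:E <=
   tail_sum mu F alpha w (m + j%:Z)%R x)%E.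
Proof.
rewrite (tail_sumE) (esum_mkcond [set _ | _]).
set t := fun l : int => _.
apply: esum_ge; exists ((fun k : nat => m + k%:Z) @` `I_n).
  by split=> //; exact/finite_image/finite_II.
have bij : set_bij `I_n ((fun k : nat => m + k%:Z) @` `I_n) (fun k : nat => m + k%:Z).
  by split=> [k kn|k l _ _ /addrI[]//|//]; exists k.
rewrite (reindex_fsbig _ _ _ _ bij) -(fsbig_ord _ _ (fun k : nat => t (m + k%:Z))).
rewrite big_mkcond -sumEFin; apply: lee_sum => k _; rewrite /t.
have -> : ((m + k%:Z)%R \in [set l : int | (m + j%:Z <= l)%R]) = (j <= k)%N.
  by apply/idP/idP; rewrite inE/= lerD2l lez_nat.
by case: (j <= k)%N.
Qed.

(** Hoelder's inequality on [E]; the finite sum is real-valued and bounded by the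
tail sum. *)
Lemma testing_window (q q' p e C : R) (m : int) n (j : nat) E : 1 < q -> q^-1 + q'^-1 = 1 ->
  0 < q' -> 0 <= e -> p^-1 + q'^-1 = 1 + e -> 0 <= C ->
  testing_bound mu F alpha w q p C -> finite_part mu (F (m + j%:Z)) E ->
  (\int[mu]_(x in E) ((\sum_(k < n | (j <= k)%N)
      cexp (m + k%:Z)%R w x * alpha (m + k%:Z)%R x) * w x)%:E <=
   C%:E * wmass mu w E `^ (1 + e))%E.
Proof.
move=> q1 qq' q'0 e0 pe C0 tb fE; have q0 : 0 < q by exact: lt_trans q1.
have mE := sub_measurable (sF _) fE.1.
pose s x := \sum_(k < n | (j <= k)%N) cexp (m + k%:Z) w x * alpha (m + k%:Z) x.
have s0 x : 0 <= s x by apply: sumr_ge0 => k _; rewrite mulr_ge0.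
have ms : measurable_fun [set: T] s.
  rewrite /s; under eq_fun do rewrite big_mkcond; apply: measurable_sum => k.
  case: (j <= k)%N; last exact: measurable_cst.
  by apply/(measurable_wrt_fun (sF _))/(measurable_wrtM (sF _)).
have i0 x : 0 <= \1_E x :> R by rewrite indicE.
pose u x := \1_E x * s x.
have u0 x : 0 <= u x by rewrite mulr_ge0.
have mu_ : measurable_fun [set: T] u by apply: measurable_funM => //; exact: measurable_indic.
have mass0 : (0 <= wmass mu w E)%E.
  by apply: integral_ge0 => x _; rewrite lee_fin.
have H := integral_hoelder_part mE mu_ u0 q0 q'0 qq'.
have us : (\int[mu]_(x in E) (s x * w x)%:E = \int[mu]_(x in E) (u x * w x)%:E)%E.
  by apply: eq_integral => x xE; rewrite /u indicE xE mul1r.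
rewrite [leLHS]us; apply: (le_trans H).
have tailE : (\int[mu]_x (u x `^ q * w x)%:E <=
    \int[mu]_(x in E) (tail_sum mu F alpha w (m + j%:Z)%R x `^ q * (w x)%:E))%E.
  rewrite [leRHS]integral_mkcond; apply: ge0_le_integral => //.
  - by move=> x _; rewrite lee_fin mulr_ge0// powR_ge0.
  - apply/measurable_EFinP/measurable_funM => //.
    exact: (measurableT_comp (measurable_powR _) mu_).
  - apply/(measurable_restrictT _ mE)/measurable_funTS/emeasurable_funM.
      exact: (measurableT_comp (measurable_poweR _) (measurable_tail_sum _)).
    exact/measurable_EFinP.
  - move=> x _; rewrite patchE /u indicE; case: ifPn => xE; last first.
      by rewrite mul0r powR0 ?gt_eqF// mul0r.
    rewrite mul1r EFinM; apply: lee_wpmul2r; first by rewrite lee_fin.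
    rewrite -poweR_EFin; apply: ge0_le_poweR; first exact: ltW.
      by rewrite lee_fin.
    exact: sum_le_tail_sum.
have tb' := tb _ _ fE.
apply: (@le_trans _ _ ((C%:E * wmass mu w E `^ p^-1) * wmass mu w E `^ q'^-1)%E).
  apply: lee_wpmul2r; first exact: poweR_ge0.
  apply: le_trans tb'; apply: ge0_le_poweR.
  - by rewrite invr_ge0 ltW.
  - by apply: integral_ge0 => x _; rewrite lee_fin mulr_ge0// powR_ge0.
  - exact: tailE.
rewrite -muleA -poweRD ?pe; first exact: lexx.
by rewrite /poweRD_def pe gt_eqF// ltr_wpDr.
Qed.

(** Only windows [m, ..., m + n - 1] have to be considered, by [esum_int_le]; the
filtration is re-indexed by [nat] with [m] as its first index. *)
Lemma testing_sufficient (p q q' e C cp cs cr : R) : 1 < p -> 1 < q -> 1 < q' ->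
  q^-1 + q'^-1 = 1 -> 0 <= e -> p^-1 + q'^-1 = 1 + e -> 0 <= C ->
  dyadic_bound (p - 1) cp -> dyadic_bound (q' - 1) cs -> dyadic_bound (1 + e)^-1 cr ->
  testing_bound mu F alpha w q p C ->
  bilinear_bound mu F alpha w p q'
    (C * (2 * cr * doob_const p cp `^ p^-1 * doob_const q' cs `^ q'^-1)).
Proof.
move=> p1 q1 q'1 qq' e0 pe C0 Hp Hs Hr tb f h f0 h0 Lf Lh.
have p0 : 0 < p by exact: lt_trans p1.
have q'0 : 0 < q' by exact: lt_trans q'1.
have nf i : nonneg_integrable mu (F i) (f \* w).
  exact: (Lpw_nonneg_integrable i p1 f0 Lf).
have nh i : nonneg_integrable mu (F i) (h \* w).
  exact: (Lpw_nonneg_integrable i q'1 h0 Lh).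
rewrite (T_op_norm_esum nf nh).
have ipow (v : T -> R) (t : R) : (0 <= \int[mu]_x (v x `^ t * w x)%:E)%E.
  by apply: integral_ge0 => x _; rewrite lee_fin mulr_ge0// powR_ge0.
apply: esum_int_le => [i|m n].
  by apply: integral_ge0 => x _; rewrite lee_fin !mulr_ge0.
under eq_bigr do rewrite integral_cexpM//.
pose G (k : nat) := F (m + k%:Z).
have sG k : sigma_finite_sub mu (G k) by exact: sF.
have G_mono (j k : nat) : (j <= k)%N -> G j `<=` G k.
  by move=> jk; apply: (filtration_le); rewrite lerD2l lez_nat.
have w_fin k E : finite_part mu (G k) E -> (wmass mu w E < +oo)%E.
  exact: wmass_lty.
pose lam (k : nat) x := cexp (m + k%:Z) w x * alpha (m + k%:Z) x.
pose phi (k : nat) := wavg (m + k%:Z) f.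
pose psi (k : nat) := wavg (m + k%:Z) h.
have alam : adapted G lam.
  by move=> k; split; [exact: (measurable_wrtM (sF _))|move=> x; rewrite mulr_ge0].
have aphi : adapted G phi.
  by move=> k; split; [exact: measurable_wrt_wavg|move=> x; exact: wavg_ge0].
have apsi : adapted G psi.
  by move=> k; split; [exact: measurable_wrt_wavg|move=> x; exact: wavg_ge0].
have tG (j : nat) E : (j < n)%N -> finite_part mu (G j) E ->
    (\int[mu]_(x in E) ((\sum_(i < n | (j <= i)%N) lam i x) * w x)%:E <=
     C%:E * wmass mu w E `^ (1 + e))%E.
  by move=> _ fE; exact: (testing_window n q1 qq' q'0 e0 pe C0 tb fE).
have favg k E : finite_part mu (G k) E ->
    (\int[mu]_(x in E) (phi k x * w x)%:E <= \int[mu]_(x in E) (f x * w x)%:E)%E.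
  exact: integral_wavg_le.
have havg k E : finite_part mu (G k) E ->
    (\int[mu]_(x in E) (psi k x * w x)%:E <= \int[mu]_(x in E) (h x * w x)%:E)%E.
  exact: integral_wavg_le.
have mf : measurable_fun [set: T] f by case: Lf.
have mh : measurable_fun [set: T] h by case: Lh.
have Foo := in_Lpw_lty p0 f0 Lf; have Hoo := in_Lpw_lty q'0 h0 Lh.
have := finite_bilinear_bound mw w0 sG G_mono w_fin alam aphi apsi mf f0 mh h0
  favg havg p1 q'1 e0 C0 pe Hp Hs Hr tG Foo Hoo.
move=> HH; apply: (le_trans HH).
have dp0 := doob_const_ge0 p Hp.1; have ds0 := doob_const_ge0 q' Hs.1.
rewrite (wnormE p f0) (wnormE q' h0).
apply: eq_lee.
exact: poweR_mul_factor dp0 ds0 (ipow f p) (ipow h q').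
Qed.

End weighted_operator.

(** * The equivalence and the constants *)

Theorem corollary1p4 (R : realType) (p q p' q' : R)
    (p_gt1 : 1 < p) (le_pq : p <= q)
    (pp' : p^-1 + p'^-1 = 1) (qq' : q^-1 + q'^-1 = 1) :
  exists K : R, 0 < K /\
  forall (d : measure_display) (T : measurableType d)
    (mu : {measure set T -> \bar R}) (F : int -> set (set T))
    (alpha : int -> T -> R) (w : T -> R),
  sigma_finite_filtration mu F -> admissible F alpha -> weight mu F w ->
  [/\ (exists C : R, 0 < C /\ bilinear_bound mu F alpha w p q' C) <->
      (exists C1 C2 : R, [/\ 0 < C1, 0 < C2,
         testing_bound mu F alpha w q p C1 &
         testing_bound mu F alpha w p' q' C2]),
      (testing_const mu F alpha w q p <= T_op_norm mu F alpha w p q')%E,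
      (testing_const mu F alpha w p' q' <= T_op_norm mu F alpha w p q')%E &
      (T_op_norm mu F alpha w p q' <=
        K%:E * (testing_const mu F alpha w q p
                + testing_const mu F alpha w p' q'))%E].
Proof.
have q_gt1 : 1 < q by exact: lt_le_trans le_pq.
have conj_gt1 (a b : R) : 1 < a -> a^-1 + b^-1 = 1 -> 1 < b.
  move=> a1 ab; have a0 : 0 < a by exact: lt_trans a1.
  have bV : b^-1 = 1 - a^-1 by rewrite -ab addrC addKr.
  by rewrite -[b]invrK bV invf_gt1 ?subr_gt0 ?invf_lt1// gtrBl invr_gt0.
have p'_gt1 := conj_gt1 _ _ p_gt1 pp'; have q'_gt1 := conj_gt1 _ _ q_gt1 qq'.
(* [1 + e = 1/p + 1/q'] measures by how much the exponents fail to be dual. *)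
pose e := p^-1 - q^-1.
have e0 : 0 <= e by rewrite subr_ge0 lef_pV2 ?posrE// (lt_trans ltr01).
have pe : p^-1 + q'^-1 = 1 + e by rewrite -qq' /e; ring.
have r0 : 0 < (1 + e)^-1 by rewrite invr_gt0 ltr_wpDr.
have [cp Hp] : exists c, dyadic_bound (p - 1) c by apply: ex_dyadic_bound; rewrite subr_gt0.
have [cs Hs] : exists c, dyadic_bound (q' - 1) c by apply: ex_dyadic_bound; rewrite subr_gt0.
have [cr Hr] : exists c, dyadic_bound (1 + e)^-1 c by exact: ex_dyadic_bound.
have doob_gt0 (a c : R) : 0 < c -> 0 < doob_const a c.
  by move=> ?; rewrite !mulr_gt0// powR_gt0.
pose K := 2 * cr * doob_const p cp `^ p^-1 * doob_const q' cs `^ q'^-1.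
have K0 : 0 < K.
  by rewrite !mulr_gt0 ?powR_gt0 ?doob_gt0//; [case: Hr|case: Hp|case: Hs].
exists K; split => // d T mu F alpha w filF admF wF.
have suffi C : 0 <= C -> testing_bound mu F alpha w q p C ->
    bilinear_bound mu F alpha w p q' (C * K).
  move=> C0.
  exact: (testing_sufficient filF admF wF p_gt1 q_gt1 q'_gt1 qq' e0 pe C0 Hp Hs Hr).
have nec1 C : 0 <= C -> bilinear_bound mu F alpha w p q' C ->
    testing_bound mu F alpha w q p C.
  move=> C0.
  exact: (testing_necessary filF admF wF p_gt1 q_gt1 qq' C0).
(* The form is symmetric, so its two arguments and exponents can be exchanged. *)
have nec2 C : 0 <= C -> bilinear_bound mu F alpha w p q' C ->
    testing_bound mu F alpha w p' q' C.
  have p'p : p'^-1 + p^-1 = 1 by rewrite addrC.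
  move=> C0 bb; apply: (testing_necessary filF admF wF q'_gt1 p'_gt1 p'p C0).
  move=> f g f0 g0 Lf Lg.
  have := bb g f g0 f0 Lg Lf; rewrite muleAC => H; apply: le_trans H.
  apply: eq_lee; congr (Lnorm _ _ _).
  by apply/funext => x; apply: eq_esum => i _; rewrite mulrAC.
have tc_ge0 r s : (0 <= testing_const mu F alpha w r s)%E.
  by apply: le_ereal_inf_tmp => _ [C [C0 _] <-]; rewrite lee_fin.
split.
- split=> [[C [C0 bb]]|[C1 [_ [C10 _ tb _]]]].
    exists C, C; split=> //; first exact/nec1/bb/ltW.
    by apply: nec2 => //; exact: ltW.
  by exists (C1 * K); split; [rewrite mulr_gt0|apply: suffi => //; exact: ltW].
- by apply: ereal_inf_le_tmp => _ [C [C0 bb] <-]; exists C => //; split=> //; exact: nec1.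
- by apply: ereal_inf_le_tmp => _ [C [C0 bb] <-]; exists C => //; split=> //; exact: nec2.
- rewrite -lee_pdivrMl//.
  apply: (@le_trans _ _ (testing_const mu F alpha w q p)); last by rewrite leeDl.
  apply: le_ereal_inf_tmp => _ [C [C0 tb] <-]; rewrite lee_pdivrMl//.
  apply: ereal_inf_lbound; exists (C * K); last by rewrite -EFinM mulrC.
  by split; [rewrite mulr_ge0// ltW|exact: suffi].
Qed.
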